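(* Let $q$ be a power of a prime $p$, and fix a finite set $\mathcal{K}=\{r_1,\ldots,r_k\}\subset \mathbb{N}$ with $(r_i,p)=1$ for every $1\leq i\leq k$. There exist positive constants $c,C,D$, depending only on $\mathcal{K}$ and $q$, such that the following holds. Let $n\in\mathbb{N}$ be sufficiently large in terms of $\mathcal{K}$ and $q$. Suppose that $P(f)=\alpha_1f^{r_1}+\cdots+\alpha_kf^{r_k}$ is a polynomial with coefficients $\alpha_1,\ldots,\alpha_k$ in $\mathbb{K}_{\infty}=\mathbb{F}_q((1/t))$ satisfying the bound \[ \left|\sum_{\substack{f\in\mathbb{F}_q[t]\\ \deg f<n}}e(\alpha_1f^{r_1}+\cdots+\alpha_kf^{r_k})\right|\ge q^{n-\eta} \] for some real $0 \leq \eta\le cn$. Then, for any $1\leq i\leq k$, there exist $a_i\in\mathbb{F}_q[t]$ and monic $g_i\in\mathbb{F}_q[t]$ such that \[ \operatorname{ord}(g_i\alpha_i-a_i)<-r_in+C\eta + D \qquad\text{and}\qquad \deg g_i\le C\eta + D. \]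
   Context: $\mathbb{N}$ is the set of positive integers; $\deg 0=-\infty$. Every nonzero $\alpha\in\mathbb{K}_\infty=\mathbb{F}_q((1/t))$ has a unique expansion $\alpha=\sum_{j\le J}a_jt^j$ with $a_j\in\mathbb{F}_q$, $a_J\ne0$; set $\operatorname{ord}\alpha:=J$ and $\operatorname{ord}0:=-\infty$. Let $\operatorname{res}\alpha:=a_{-1}$ (zero if no $t^{-1}$ term appears) and define the additive character $e(\alpha):=\exp\left(\frac{2\pi i}{p}\operatorname{Tr}_{\mathbb{F}_q/\mathbb{F}_p}(\operatorname{res}\alpha)\right)$ on $\mathbb{K}_\infty$. *)

(* Defs.v *)
From HB Require Import structures.
From mathcomp Require Import all_boot all_order all_algebra all_field.
From mathcomp Require Import complex finmap zify ring.
From mathcomp Require Import all_classical all_reals all_analysis.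

Set Implicit Arguments.
Unset Strict Implicit.
Unset Printing Implicit Defensive.

Import Order.TTheory GRing.Theory Num.Theory.

Local Open Scope classical_set_scope.
Local Open Scope ring_scope.

(* The field F((1/t)): [lcoef a j] is the coefficient of t^j in a, and only   *)
(* finitely many positive powers of t occur.                                  *)
Record laurent (F : fieldType) := Laurent {
  lcoef : int -> F;
  lcoef_bounded : exists J : int, forall j, J < j -> lcoef j = 0
}.

HB.instance Definition _ (F : fieldType) := gen_eqMixin (laurent F).
HB.instance Definition _ (F : fieldType) := gen_choiceMixin (laurent F).

Lemma laurentP (F : fieldType) (a b : laurent F) :
  (forall j, lcoef a j = lcoef b j) -> a = b.
Proof.
case: a b => [a Ha] [b Hb] /= /funext ab; subst b.
by congr Laurent; exact: Prop_irrelevance.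
Qed.

Section LaurentZmodule.
Variable F : fieldType.
Implicit Types a b c : laurent F.

Fact lzero_subproof :
  exists J : int, forall j, J < j -> (fun _ : int => 0 : F) j = 0.
Proof. by exists 0. Qed.
Definition lzero := Laurent lzero_subproof.

Fact ladd_subproof a b :
  exists J : int, forall j, J < j -> lcoef a j + lcoef b j = 0.
Proof.
have [A HA] := lcoef_bounded a; have [B HB] := lcoef_bounded b.
exists (Num.max A B) => j; rewrite gt_max => /andP[Aj Bj].
by rewrite HA // HB // addr0.
Qed.
Definition ladd a b := Laurent (ladd_subproof a b).

Fact lopp_subproof a : exists J : int, forall j, J < j -> - lcoef a j = 0.
Proof.
by have [A HA] := lcoef_bounded a; exists A => j /HA ->; rewrite oppr0.
Qed.
Definition lopp a := Laurent (lopp_subproof a).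

Fact laddA : associative ladd.
Proof. by move=> a b c; apply: laurentP => j /=; rewrite addrA. Qed.
Fact laddC : commutative ladd.
Proof. by move=> a b; apply: laurentP => j /=; rewrite addrC. Qed.
Fact ladd0 : left_id lzero ladd.
Proof. by move=> a; apply: laurentP => j /=; rewrite add0r. Qed.
Fact laddN : left_inverse lzero lopp ladd.
Proof. by move=> a; apply: laurentP => j /=; rewrite addNr. Qed.

HB.instance Definition _ :=
  GRing.isZmodule.Build (laurent F) laddA laddC ladd0 laddN.

Lemma lcoef0 j : lcoef (0 : laurent F) j = 0. Proof. by []. Qed.
Lemma lcoefD a b j : lcoef (a + b) j = lcoef a j + lcoef b j.
Proof. by []. Qed.
Lemma lcoefN a j : lcoef (- a) j = - lcoef a j. Proof. by []. Qed.

End LaurentZmodule.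

Section LaurentRing.
Variable F : fieldType.
Implicit Types a b c : laurent F.

(* The sum has finite support because lcoef a and lcoef b vanish at large     *)
(* indices; the finitely supported sum over all of int is therefore genuine.  *)
Definition lmul_coef a b (n : int) : F :=
  \sum_(i \in [set: int]) lcoef a i * lcoef b (n - i).

Definition lbounded a (A : int) := forall j, A < j -> lcoef a j = 0.

(* The first m coefficients of t^(- A) * a, read downwards.                   *)
Definition ltrunc (A : int) m a : {poly F} := \poly_(i < m) lcoef a (A - i%:Z).

Lemma lmul_coef_big a b A B n :
  lbounded a A -> lbounded b B -> A + B < n -> lmul_coef a b n = 0.
Proof.
move=> HA HB ABn; apply: fsbig1 => i _.
have [Ai|iA] := ltP A i; first by rewrite HA // mul0r.
by rewrite (HB (n - i)) ?mulr0 //; lia.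
Qed.

Lemma lmul_coef_ltrunc a b A B m (k : nat) :
  lbounded a A -> lbounded b B -> (k < m)%N ->
  lmul_coef a b (A + B - k%:Z) = (ltrunc A m a * ltrunc B m b)`_k.
Proof.
move=> HA HB km; rewrite /lmul_coef.
pose r := [seq A - i%:Z | i <- iota 0 k.+1].
have r_uniq : uniq r.
  by rewrite map_inj_uniq ?iota_uniq // => i j /addrI /oppr_inj [].
rewrite (@fsbigE _ _ _ _ _ r) //; last first.
  move=> i _ ir.
  have [Ai|iA] := ltP A i; first by rewrite HA // mul0r.
  rewrite (HB (A + B - k%:Z - i)) ?mulr0 //.
  apply: contraR ir; rewrite -leNgt => Bi; apply/mapP.
  by exists (absz (A - i)%R); [rewrite mem_iota |]; lia.
rewrite /r coefM big_map -[iota _ _]/(index_iota 0 k.+1).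
rewrite (eq_bigl xpredT); last by move=> i; rewrite in_setT.
rewrite big_mkord; apply: eq_bigr => i _.
have ik : (i <= k)%N by rewrite -ltnS.
rewrite !coef_poly (leq_ltn_trans ik km) (leq_ltn_trans (leq_subr i k) km).
by congr (_ * lcoef b _); lia.
Qed.

Fact lmul_subproof a b :
  exists J : int, forall j, J < j -> lmul_coef a b j = 0.
Proof.
have [A HA] := lcoef_bounded a; have [B HB] := lcoef_bounded b.
by exists (A + B) => j; exact: lmul_coef_big.
Qed.
Definition lmul a b := Laurent (lmul_subproof a b).

Lemma lbounded_lmul a b A B :
  lbounded a A -> lbounded b B -> lbounded (lmul a b) (A + B).
Proof. by move=> HA HB j; exact: lmul_coef_big. Qed.

Lemma lboundedW a A A' : lbounded a A -> A <= A' -> lbounded a A'.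
Proof. by move=> HA AA' j A'j; apply: HA; exact: le_lt_trans A'j. Qed.

Fact lmulC : commutative lmul.
Proof.
move=> a b; apply: laurentP => n.
have [A HA] := lcoef_bounded a; have [B HB] := lcoef_bounded b.
have [ABn|nAB] := ltP (A + B) n.
  rewrite (lbounded_lmul HA HB) // (lbounded_lmul HB HA) //.
  by rewrite addrC.
have -> : n = A + B - (absz (A + B - n)%R)%:Z by lia.
set k := absz _; rewrite /= (lmul_coef_ltrunc HA HB (ltnSn k)).
by rewrite (addrC A B) (lmul_coef_ltrunc HB HA (ltnSn k)) mulrC.
Qed.

Lemma ltrunc_lmul a b A B m (i : nat) :
  lbounded a A -> lbounded b B -> (i < m)%N ->
  (ltrunc (A + B) m (lmul a b))`_i = (ltrunc A m a * ltrunc B m b)`_i.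
Proof.
by move=> HA HB im; rewrite coef_poly im /= (lmul_coef_ltrunc HA HB im).
Qed.

Lemma coefM_eq (p p' s s' : {poly F}) k :
  (forall i, (i <= k)%N -> p`_i = p'`_i) ->
  (forall i, (i <= k)%N -> s`_i = s'`_i) -> (p * s)`_k = (p' * s')`_k.
Proof.
move=> pp' ss'; rewrite !coefM; apply: eq_bigr => i _.
by rewrite pp' ?ss' // ?leq_subr // -ltnS.
Qed.

Fact lmulA : associative lmul.
Proof.
move=> a b c; apply: laurentP => n.
have [A HA] := lcoef_bounded a; have [B HB] := lcoef_bounded b.
have [C HC] := lcoef_bounded c.
have [ABn|nAB] := ltP (A + B + C) n.
  rewrite (lbounded_lmul (lbounded_lmul HA HB) HC) //.
  by rewrite (lbounded_lmul HA (lbounded_lmul HB HC)) // addrA.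
have -> : n = A + B + C - (absz (A + B + C - n)%R)%:Z by lia.
set k := absz _ => /=.
rewrite (lmul_coef_ltrunc (lbounded_lmul HA HB) HC (ltnSn k)).
rewrite -[A + B + C]addrA.
rewrite (lmul_coef_ltrunc HA (lbounded_lmul HB HC) (ltnSn k)).
transitivity (ltrunc A k.+1 a * (ltrunc B k.+1 b * ltrunc C k.+1 c))`_k.
  by apply: coefM_eq => // i ik; rewrite ltrunc_lmul.
by rewrite mulrA; apply: coefM_eq => // i ik; rewrite ltrunc_lmul.
Qed.

Fact lone_subproof :
  exists J : int, forall j, J < j -> ((j == 0)%:R : F) = 0.
Proof. by exists 0 => j j0; rewrite gt_eqF. Qed.
Definition lone : laurent F := Laurent lone_subproof.

Fact lmul1 : left_id lone lmul.
Proof.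
move=> a; apply: laurentP => n /=; rewrite /lmul_coef.
rewrite (@fsbigE _ _ _ _ _ [:: 0 : int]) //.
  by rewrite big_mkcond big_seq1 in_setT /= mul1r subr0.
by move=> i _; rewrite inE => /negPf /= ->; rewrite mul0r.
Qed.

Fact lmulDl : left_distributive lmul +%R.
Proof.
move=> a b c; apply: laurentP => n.
have [A0 HA0] := lcoef_bounded a; have [B0 HB0] := lcoef_bounded b.
have [C HC] := lcoef_bounded c.
pose A := Num.max A0 B0.
have HA : lbounded a A by apply: lboundedW HA0 _; rewrite le_max lexx.
have HB : lbounded b A by apply: lboundedW HB0 _; rewrite le_max lexx orbT.
have HAB : lbounded (a + b) A by move=> j Aj; rewrite lcoefD HA // HB // addr0.
have [ABn|nAB] := ltP (A + C) n.
  by rewrite lcoefD !(lbounded_lmul _ HC ABn) ?addr0.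
have -> : n = A + C - (absz (A + C - n)%R)%:Z by lia.
set k := absz _; rewrite lcoefD /= !(lmul_coef_ltrunc _ HC (ltnSn k)) //.
rewrite -coefD -mulrDl.
suff -> : ltrunc A k.+1 (a + b) = ltrunc A k.+1 a + ltrunc A k.+1 b by [].
by apply/polyP => i; rewrite coefD !coef_poly; case: ifP; rewrite ?addr0.
Qed.

Fact lone_neq0 : lone != 0.
Proof.
by apply/eqP => /(congr1 (fun a => lcoef a 0)) /eqP; rewrite /= oner_eq0.
Qed.

HB.instance Definition _ := GRing.Zmodule_isComNzRing.Build (laurent F)
  lmulA lmulC lmul1 lmulDl lone_neq0.

Lemma lcoefM a b n :
  lcoef (a * b) n = \sum_(i \in [set: int]) lcoef a i * lcoef b (n - i).
Proof. by []. Qed.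
Lemma lcoef1 j : lcoef (1 : laurent F) j = (j == 0)%:R. Proof. by []. Qed.

End LaurentRing.

(* J is the order of a: the largest exponent of t occurring in a.             *)
Definition leads (F : fieldType) (a : laurent F) (J : int) :=
  lcoef a J != 0 /\ forall j, J < j -> lcoef a j = 0.

Lemma leads_exists (F : fieldType) (a : laurent F) :
  a != 0 -> exists J, leads a J.
Proof.
move=> a0; have [A HA] := lcoef_bounded a.
have [j aj] : exists j, lcoef a j != 0.
  apply/not_existsP => H; move/eqP: a0; apply; apply: laurentP => j.
  by apply/eqP; rewrite -[_ == _]negbK; apply/negP/H.
have ex : exists k : nat, lcoef a (A - k%:Z) != 0.
  exists (absz (A - j)%R); have jA : j <= A.
    by rewrite leNgt; apply: contra aj => /HA ->.
  by have -> : A - (absz (A - j)%R)%:Z = j by lia.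
case: (ex_minnP ex) => k ak kmin; exists (A - k%:Z); split=> // i ki.
have [/HA //|iA] := ltP A i; apply/eqP; apply: contraTT ki => ai.
rewrite -leNgt; have := kmin (absz (A - i)%R).
rewrite (_ : A - (absz (A - i)%R)%:Z = i); last by lia.
by move=> /(_ ai); lia.
Qed.

Lemma leads_inj (F : fieldType) (a : laurent F) J J' :
  leads a J -> leads a J' -> J = J'.
Proof.
move=> [aJ HJ] [aJ' HJ']; apply/eqP; rewrite eq_le !leNgt.
by apply/andP; split; [move: aJ|move: aJ']; apply: contra => /[dup];
   [move/HJ'|move/HJ] => ->.
Qed.

Section LaurentField.
Variable F : fieldType.
Implicit Types a b : laurent F.

(* The first n coefficients of the inverse of the power series s.             *)
Fixpoint inv_seq (s : nat -> F) n : seq F :=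
  if n is m.+1 then
    let t := inv_seq s m in
    rcons t ((s 0%N)^-1 * ((m == 0%N)%:R - \sum_(i < m) t`_i * s (m - i)%N))
  else [::].

Lemma size_inv_seq s n : size (inv_seq s n) = n.
Proof. by elim: n => //= n IH; rewrite size_rcons IH. Qed.

Lemma nth_inv_seq s n i : (i < n)%N -> (inv_seq s n)`_i = (inv_seq s i.+1)`_i.
Proof.
elim: n => // n IH; rewrite ltnS leq_eqVlt => /orP[/eqP -> //|lt_in].
by rewrite /= nth_rcons size_inv_seq lt_in IH.
Qed.

Lemma laurent_inv_exists a : a != 0 -> exists b, b * a = 1.
Proof.
move=> /leads_exists[A [aA HA]].
pose s i := lcoef a (A - i%:Z); pose t i := (inv_seq s i.+1)`_i.
have ts m : \sum_(i < m.+1) t i * s (m - i)%N = (m == 0%N)%:R.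
  rewrite big_ord_recr /= subnn {2}/t /= nth_rcons size_inv_seq ltnn eqxx.
  rewrite mulrAC mulVf ?mul1r; last by rewrite /s subr0.
  set S := (X in _ + (_ - X)); set S' := (X in X + _).
  suff -> : S' = S by rewrite addrC subrK.
  by apply: eq_bigr => i _ /=; rewrite nth_inv_seq.
pose tc (j : int) : F := if j <= - A then t (absz (- A - j)%R) else 0.
have Ht : exists J : int, forall j, J < j -> tc j = 0.
  by exists (- A) => j; rewrite ltNge /tc => /negPf ->.
pose b := Laurent Ht.
have HB : lbounded b (- A) by move=> j; rewrite ltNge /= /tc => /negPf ->.
exists b; apply: laurentP => n; rewrite lcoef1.
have [n0|n0] := ltP 0 n.
  by rewrite (lbounded_lmul HB HA) ?addNr // gt_eqF.
have -> : n = - A + A - (absz n)%:Z by lia.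
set k := absz _; rewrite [LHS](lmul_coef_ltrunc HB HA (ltnSn k)) coefM.
transitivity (\sum_(i < k.+1) t i * s (k - i)%N).
  apply: eq_bigr => i _; rewrite !coef_poly ltn_ord ltnS leq_subr /= /tc.
  rewrite (_ : (- A - i%:Z <= - A) = true); last by lia.
  by congr (t _ * _); lia.
by rewrite ts addNr sub0r oppr_eq0.
Qed.

Definition linv a : laurent F :=
  if a == 0 then 0 else xget 0 [set b | b * a = 1].

Fact lmulVf a : a != 0 -> linv a * a = 1.
Proof.
move=> a0; rewrite /linv (negPf a0); have [b ba] := laurent_inv_exists a0.
exact: (@xgetI _ 0 [set b | b * a = 1] b ba).
Qed.

Fact linv0 : linv 0 = 0. Proof. by rewrite /linv eqxx. Qed.

HB.instance Definition _ :=
  GRing.ComNzRing_isField.Build (laurent F) lmulVf linv0.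

End LaurentField.

Section PolyLaurent.
Variable F : fieldType.

Definition lpoly_coef (f : {poly F}) (j : int) : F :=
  if j is Posz i then f`_i else 0.

Fact lpoly_subproof (f : {poly F}) :
  exists J : int, forall j, J < j -> lpoly_coef f j = 0.
Proof.
exists (size f)%:Z => -[i|//] /= fi; rewrite nth_default //.
by move: fi; lia.
Qed.

(* The inclusion of F[t] in F((1/t)).                                         *)
Definition lpoly f : laurent F := Laurent (lpoly_subproof f).

Fact lpoly_is_zmod_morphism : zmod_morphism lpoly.
Proof.
move=> f g; apply: laurentP => -[i|i] /=; first by rewrite coefB.
by rewrite oppr0 addr0.
Qed.
HB.instance Definition _ :=
  GRing.isZmodMorphism.Build {poly F} (laurent F) lpoly lpoly_is_zmod_morphism.

Fact lpoly_is_monoid_morphism : monoid_morphism lpoly.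
Proof.
split=> [|f g]; apply: laurentP => -[n|n].
- by rewrite lcoef1 /= coef1.
- by [].
- rewrite lcoefM /= coefM (@fsbigE _ _ _ _ _ [seq i%:Z | i <- iota 0 n.+1]) //.
  + rewrite big_map -[iota _ _]/(index_iota 0 n.+1).
    rewrite (eq_bigl xpredT); last by move=> i; rewrite in_setT.
    rewrite big_mkord; apply: eq_bigr => i _ /=.
    have ik : (i <= n)%N by rewrite -ltnS.
    by rewrite subzn.
  + by rewrite map_inj_uniq ?iota_uniq // => i j [].
  + move=> [i|i] _ ni /=; last by rewrite mul0r.
    case E: (n%:Z - i%:Z) => [j|j] /=; last by rewrite mulr0.
    by case/mapP: ni; exists i => //; rewrite mem_iota; lia.
- rewrite lcoefM /= fsbig1 // => -[i|i] _ /=; last by rewrite mul0r.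
  by case E: (Negz n - i%:Z) => [j|j] /=; [lia|rewrite mulr0].
Qed.
HB.instance Definition _ := GRing.isMonoidMorphism.Build
  {poly F} (laurent F) lpoly lpoly_is_monoid_morphism.

End PolyLaurent.

(* ord takes the value -oo at 0, hence lives in the extended reals.           *)
Definition ord (R : realType) (F : fieldType) (a : laurent F) : \bar R :=
  if a == 0 then -oo%E else ((xget 0 [set J | leads a J])%:~R : R)%:E.

Lemma ord0E (R : realType) (F : fieldType) : ord R (0 : laurent F) = -oo%E.
Proof. by rewrite /ord eqxx. Qed.

Lemma ord_leads (R : realType) (F : fieldType) (a : laurent F) J :
  leads a J -> ord R a = (J%:~R)%:E.
Proof.
move=> aJ; rewrite /ord ifF; last first.
  by apply/eqP => a0; case: aJ; rewrite a0 eqxx.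
have := @xgetI _ 0 [set J | leads a J] J aJ.
by move=> /leads_inj /(_ aJ) ->.
Qed.

Definition res (F : fieldType) (a : laurent F) : F := lcoef a (- 1).

Section AdditiveCharacter.
Variables (R : realType) (F : finFieldType) (p : nat).
Variable charF : p \in [pchar F].

(* F viewed as a finite extension of its prime field 'F_p.                    *)
Local Notation L := (pPrimeCharType charF).

(* galTrace takes values in L; the coordinate on the basis 1 of the line 1%VS *)
(* brings it back to 'F_p, cf. Fp_traceE.                                     *)
Definition Fp_trace (x : F) : 'F_p :=
  coord [tuple (1 : L)] ord0 (galTrace 1%AS (fullv : {subfield L}) (x : L)).

Lemma Fp_traceE (x : F) :
  (Fp_trace x)%:A = galTrace 1%AS (fullv : {subfield L}) (x : L).
Proof.
set y := galTrace _ _ _.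
have : y \in <<[tuple (1%R : L)]>>%VS.
  rewrite span_seq1; apply: mem_galTrace (memvf _).
  exact: finField_galois (sub1v _).
by move=> /coord_span ->; rewrite big_ord1.
Qed.

(* exp(i * x) for real x.                                                     *)
Definition cis (x : R) : R[i] := (cos x +i* sin x)%C.

(* An element of 'F_p is read as its representative in {0, ..., p - 1}.       *)
Definition addchar (a : laurent F) : R[i] :=
  cis (2 * pi / p%:R * (Fp_trace (res a) : nat)%:R).

End AdditiveCharacter.

(* Main.v *)
From HB Require Import structures.
Require Import Defs.
From mathcomp Require Import all_boot all_order all_algebra all_field.
From mathcomp Require Import complex finmap zify ring.
From mathcomp Require Import all_classical all_reals all_analysis.

Set Implicit Arguments.
Unset Strict Implicit.
Unset Printing Implicit Defensive.

Import Order.TTheory GRing.Theory Num.Theory.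

Local Open Scope ring_scope.

(** Write an exponent r in base p as a sum of powers p^i, each repeated as
    often as the digit says.  As f -> f^(p^i) is additive, f^r is a product of
    d additive functions, where d is the digit sum of r, so it has degree d in
    the sense of differences.  This is what keeps Weyl differencing alive for
    exponents beyond the characteristic, where the usual leading factor r! is
    zero: d differences turn f^r into a multilinear form whose coefficients are
    products of factorials of digits, and these are nonzero modulo p.

    Let d be the largest digit sum among the exponents.  If the sum has size at
    least q^(n - k), then [weyl_differencing] shows that for a proportion
    q^(-O(k)) of all tuples (h_1, ..., h_(d-1)) a form
       sum over (i_0, ..., i_(d-1)) of
         A(i_0, ..., i_(d-1)) y^(p^i_0) h_1^(p^i_1) ... h_(d-1)^(p^i_(d-1))
    is annihilated by the character for all y of degree below n.  The
    coefficients belonging to an exponent r are the rearrangements of its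
    digits, and they are nonzero multiples of the coefficient alpha_r.  All
    the coefficients are mixed, both among the rearrangements and among the
    exponents of digit sum d.  They are separated by scaling variables with
    powers of t: the form with h_j scaled by t^(p^I) minus the form with y
    scaled by t^(p^b) loses the coefficients with i_j - i_0 = b - I, and the
    set of good tuples keeps a positive power of its density because its
    fibres in each variable are subgroups ([avg_pulled], [avg_twists]).  Only
    tuples with prescribed differences i_j - i_0 survive.  Since r is prime to
    p, every relevant tuple contains the exponent 0, and such a tuple is
    determined by its differences ([twists_isolate]).  With i_0 = 0 this gives
    many (h_1, ..., h_(d-1)) for which
       W alpha_r h_1^(p^i_1) ... h_(d-1)^(p^i_(d-1))
    is within q^(-n + O(1)) of a polynomial, W being a fixed nonzero
    polynomial.  Removing the h_j one at a time by a pigeonhole argument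
    ([small_of_dense], [small_of_dense_multi]) yields a denominator of degree
    O(k + 1) for alpha_r, with error below q^(-rn + O(k + 1)).

    Once the exponents of digit sum larger than d are known to be approximable,
    let g be a common denominator.  On a progression f_0 + g z with z of degree
    below n - O(k + 1) their terms are constant modulo the kernel of the
    character.  Some such progression carries as large a mean as before, and
    expanding (f_0 + g z)^r in z multiplies the leading coefficients of the
    next digit sum by g^r and otherwise only creates terms of lower degree in
    the sense of differences ([layer_step]).  Descending through the digit
    sums reaches all the exponents. *)

(** * Means, differences and Weyl differencing *)

Lemma le_indic (C : numDomainType) (P Q : Prop) : (P -> Q) ->
  (`[< P >])%:R <= (`[< Q >])%:R :> C.
Proof.
by move=> PQ; rewrite ler_nat; case: asboolP => // /PQ /asboolT ->.
Qed.

Section Averages.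
Variables (C : numFieldType) (G : finType).
Implicit Types (f g : G -> C) (F : seq G -> C).

Definition mean f : C := (\sum_x f x) / #|G|%:R.

(** The mean over G^k, as nested means over lists, so that any one variable can
    be peeled off or moved to the outside. *)
Fixpoint avg k F : C :=
  if k is k'.+1 then mean (fun h => avg k' (fun l => F (h :: l))) else F [::].

Lemma eq_mean f g : f =1 g -> mean f = mean g.
Proof. by move=> fg; congr (_ / _); apply: eq_bigr. Qed.

Lemma le_mean f g : (forall x, f x <= g x) -> mean f <= mean g.
Proof. by move=> fg; rewrite ler_wpM2r ?invr_ge0 ?ler0n // ler_sum. Qed.

Lemma mean_ge0 f : (forall x, 0 <= f x) -> 0 <= mean f.
Proof. by move=> f0; rewrite mulr_ge0 ?invr_ge0 ?ler0n // sumr_ge0. Qed.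

Lemma meanD f g : mean (fun x => f x + g x) = mean f + mean g.
Proof. by rewrite /mean big_split mulrDl. Qed.

Lemma meanZ c f : mean (fun x => c * f x) = c * mean f.
Proof. by rewrite /mean -mulr_sumr mulrA. Qed.

Lemma mean_cst c : (0 < #|G|)%N -> mean (fun=> c) = c.
Proof.
by move=> G0; rewrite /mean sumr_const -(mulr_natr c) mulfK // pnatr_eq0 -lt0n.
Qed.

Lemma mean_sqr f : (0 < #|G|)%N -> (forall x, 0 <= f x) ->
  mean f ^+ 2 <= mean (fun x => f x ^+ 2).
Proof.
move=> G0 f0; set m := mean f; rewrite -subr_ge0.
have <- : mean (fun x => (f x - m) ^+ 2) = mean (fun x => f x ^+ 2) - m ^+ 2.
  rewrite (@eq_mean _ (fun x => f x ^+ 2 + (- (m * 2) * f x + m ^+ 2))).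
    by rewrite !meanD mean_cst // meanZ -/m; ring.
  by move=> x; ring.
apply: mean_ge0 => x; apply: real_exprn_even_ge0 => //.
by rewrite rpredB ?ger0_real // mean_ge0.
Qed.

Lemma mean_pow2 k f : (0 < #|G|)%N -> (forall x, 0 <= f x) ->
  mean f ^+ (2 ^ k) <= mean (fun x => f x ^+ (2 ^ k)).
Proof.
move=> G0; elim: k f => [|k IH] f f0; first by rewrite expr1.
rewrite expnS exprM (eq_mean (fun x => exprM (f x) 2 (2 ^ k))).
apply: le_trans (IH _ _); last by move=> x; rewrite exprn_ge0.
apply: lerXn2r; last exact: mean_sqr.
  by rewrite nnegrE exprn_ge0 // mean_ge0.
by rewrite nnegrE mean_ge0 // => x; rewrite exprn_ge0.
Qed.

Lemma le_avg k F F' : (forall l, size l = k -> F l <= F' l) -> avg k F <= avg k F'.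
Proof.
elim: k F F' => [|k IH] F F' FF' /=; first exact: FF'.
by apply: le_mean => x; apply: IH => l lk; rewrite FF' //= lk.
Qed.

Lemma avg_ge0 k F : (forall l, 0 <= F l) -> 0 <= avg k F.
Proof. by elim: k F => [|k IH] F F0 //=; apply: mean_ge0 => x; apply: IH. Qed.

Lemma avgZ k c F : avg k (fun l => c * F l) = c * avg k F.
Proof.
elim: k F => [|k IH] F //=; rewrite -meanZ; apply: eq_mean => x; exact: IH.
Qed.

Lemma avgD k F F' : avg k (fun l => F l + F' l) = avg k F + avg k F'.
Proof.
elim: k F F' => [|k IH] F F' //=; rewrite -meanD; apply: eq_mean => x; exact: IH.
Qed.

Lemma avg_sum k (J : Type) (r : seq J) (F : J -> seq G -> C) :
  avg k (fun l => \sum_(j <- r) F j l) = \sum_(j <- r) avg k (F j).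
Proof.
elim: r => [|j r IH].
  rewrite big_nil (_ : (fun l => _) = fun l => 0 * 0); last first.
    by apply/funext => l; rewrite big_nil mul0r.
  by rewrite (avgZ k 0 (fun=> 0)) mul0r.
rewrite big_cons -IH -avgD; congr avg; apply/funext => l.
by rewrite big_cons.
Qed.

Lemma mean_avgC k (F : G -> seq G -> C) :
  mean (fun x => avg k (F x)) = avg k (fun l => mean (fun x => F x l)).
Proof.
rewrite /mean -avg_sum mulrC -avgZ.
by congr avg; apply/funext => l; rewrite mulrC.
Qed.

Lemma avg_sqr k F : (0 < #|G|)%N -> (forall l, 0 <= F l) ->
  avg k F ^+ 2 <= avg k (fun l => F l ^+ 2).
Proof.
move=> G0; elim: k F => [|k IH] F F0 //=.
apply: le_trans (mean_sqr G0 _) _; first by move=> x; exact: avg_ge0.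
by apply: le_mean => x; apply: IH.
Qed.

End Averages.

Lemma exists_ge_mean (C : numFieldType) (G : finType) (f : G -> C) (c : C) :
  (0 < #|G|)%N -> c \is Num.real -> (forall x, 0 <= f x) -> c <= mean f ->
  exists x, c <= f x.
Proof.
move=> G0 cr f0 cf; apply: contrapT => H.
have fc x : f x < c.
  by rewrite real_ltNge ?(ger0_real (f0 x)) //; apply/negP => cx; apply: H; exists x.
have : mean f < c.
  rewrite /mean ltr_pdivrMr ?ltr0n // mulr_natr -sumr_const.
  case/card_gt0P: G0 => x0 _; rewrite (bigD1 x0) //= [ltRHS](bigD1 x0) //=.
  by apply: ltr_leD => //; apply: ler_sum => x _; apply: ltW.
by move=> /lt_le_trans/(_ cf); rewrite ltxx.
Qed.

Section Differences.
Variables (G A : zmodType).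
Implicit Types (f : G -> A).

Definition diff (h : G) f x := f (x + h) - f x.

Definition diffs (hs : seq G) f := foldl (fun f h => diff h f) f hs.

(** [pdeg k f] expresses that f is a polynomial of degree less than k in the
    sense of differences, where Frobenius powers have degree one. *)
Fixpoint pdeg k f : Prop :=
  if k is k'.+1 then forall h, pdeg k' (diff h f) else forall x, f x = 0.

Lemma diffC h h' f : diff h (diff h' f) = diff h' (diff h f).
Proof.
apply/funext => x; rewrite /diff (addrAC x h h') !opprB.
by rewrite addrACA [RHS]addrACA; congr (_ + _); rewrite addrC.
Qed.

Lemma diffs_pdeg0 hs f : pdeg (size hs) f -> forall x, diffs hs f x = 0.
Proof.
elim: hs f => [|h hs IH] f fk x; first exact: fk.
exact: (IH _ (fk h)).
Qed.

End Differences.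

Section WeylDifferencing.
Variables (C : numClosedFieldType) (G : finZmodType) (A : zmodType) (e : A -> C).
Hypothesis eD : forall a b, e (a + b) = e a * e b.
Hypothesis e_norm : forall a, `|e a| = 1.

Let cardG : (0 < #|G|)%N. Proof. by apply/card_gt0P; exists 0. Qed.

Let e_neq0 a : e a != 0. Proof. by rewrite -normr_eq0 e_norm oner_eq0. Qed.

Lemma character0 : e 0 = 1.
Proof. by apply: (mulfI (e_neq0 0)); rewrite mulr1 -eD addr0. Qed.

Lemma characterN a : e (- a) = (e a)^*.
Proof.
apply: (mulfI (e_neq0 a)); rewrite -eD subrr character0.
by rewrite -normCK e_norm expr1n.
Qed.

(** Expanding the square gives the mean over all pairs of points, which are
    then indexed by the first point and the difference. *)
Lemma weyl_square (f : G -> A) :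
  `|mean (fun x => e (f x))| ^+ 2 <=
    mean (fun h => `|mean (fun x => e (diff h f x))|).
Proof.
have E : `|mean (fun x => e (f x))| ^+ 2 =
    mean (fun h => mean (fun x => e (diff h f x))).
  rewrite normCK /mean rmorphM fmorphV rmorph_nat rmorph_sum /=.
  rewrite mulrACA -mulr_suml -[RHS]mulrA; congr (_ * _).
  rewrite mulr_sumr [RHS]exchange_big /=; apply: eq_bigr => x _.
  rewrite mulr_suml (reindex_inj (addrI x)) /=; apply: eq_bigr => h _.
  by rewrite /diff eD characterN.
apply: le_trans (_ : `|mean (fun h => mean (fun x => e (diff h f x)))| <= _).
  by rewrite -E [leRHS]ger0_norm ?exprn_ge0.
rewrite {1 3}/mean normrM normfV normr_nat ler_wpM2r ?invr_ge0 ?ler0n //.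
exact: ler_norm_sum.
Qed.

(** A nontrivial character has mean zero, so a phase of degree one is constant
    or else cancels completely. *)
Lemma weyl_linear (f : G -> A) : pdeg 2 f ->
  `|mean (fun x => e (f x))| <= (`[< forall x, e (f x - f 0) = 1 >])%:R.
Proof.
move=> f2.
have fD y h : e (f (y + h)) = e (f y) * e (f h - f 0).
  have := f2 h y 0; rewrite /diff !add0r => /eqP; rewrite subr_eq0 => /eqP E.
  by rewrite -eD -E [f y + _]addrC subrK.
case: asboolP => [_|/existsNP[h /eqP h1]].
  rewrite /mean normrM normfV normr_nat ler_pdivrMr ?ltr0n // mul1r.
  apply: le_trans (ler_norm_sum _ _ _) _.
  by under eq_bigr do rewrite e_norm; rewrite sumr_const.
suff -> : mean (fun x => e (f x)) = 0 by rewrite normr0.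
rewrite /mean; set S := \sum_x _.
suff /eqP : S * (e (f h - f 0) - 1) = 0.
  by rewrite mulf_eq0 subr_eq0 (negPf h1) orbF => /eqP ->; rewrite mul0r.
rewrite mulrBr mulr1; apply/eqP; rewrite subr_eq0; apply/eqP.
rewrite mulr_suml [RHS](reindex_inj (addIr h)) /=.
by apply: eq_bigr => x _; rewrite fD.
Qed.

(** Repeated squaring turns a large mean into many tuples of shifts along which
    the multilinear form of the phase is trivial in its remaining variable. *)
Lemma weyl_differencing k (f : G -> A) : pdeg k.+2 f ->
  `|mean (fun x => e (f x))| ^+ (2 ^ k) <=
    avg k (fun hs => (`[< forall x, e (diffs (x :: hs) f 0) = 1 >])%:R).
Proof.
elim: k f => [|k IH] f fk.
  rewrite expr1 /=; apply: le_trans (weyl_linear fk) _.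
  by apply: le_indic => f1 x; rewrite /diffs /= /diff add0r.
rewrite expnS exprM.
apply: le_trans (_ : mean (fun h => `|mean (fun x => e (diff h f x))|) ^+ (2 ^ k) <= _).
  rewrite lerXn2r ?nnegrE ?exprn_ge0 ?weyl_square //.
  by apply: mean_ge0.
apply: le_trans (mean_pow2 _ cardG _) _ => //=.
apply: le_mean => h; apply: le_trans (IH _ (fk h)) _.
apply: le_avg => l _ /=.
by apply: le_indic => f1 x; have := f1 x; rewrite /diffs /= diffC.
Qed.

End WeylDifferencing.

(** * Monomials as products of additive functions, and their forms *)

Section DegreeCalculus.
Variables (G : zmodType) (L : comNzRingType).
Implicit Types (f g : G -> L) (hs : seq G).

Lemma pdeg_eq k f g : f =1 g -> pdeg k f -> pdeg k g.
Proof. by move=> /funext ->. Qed.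

Lemma pdegD k f g : pdeg k f -> pdeg k g -> pdeg k (fun x => f x + g x).
Proof.
elim: k f g => [|k IH] f g; first by move=> f0 g0 x; rewrite f0 g0 addr0.
move=> fk gk h; apply: pdeg_eq (IH _ _ (fk h) (gk h)) => x.
by rewrite /diff opprD addrACA.
Qed.

Lemma pdegZ k c f : pdeg k f -> pdeg k (fun x => c * f x).
Proof.
elim: k f => [|k IH] f; first by move=> f0 x; rewrite f0 mulr0.
move=> fk h; apply: pdeg_eq (IH _ (fk h)) => x.
by rewrite /diff mulrBr.
Qed.

Lemma pdeg0 k : pdeg k (fun _ : G => 0 : L).
Proof. by elim: k => // k IH h; apply: pdeg_eq IH => x; rewrite /diff subr0. Qed.

Lemma pdeg_sum k (J : eqType) (r : seq J) (f : J -> G -> L) :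
  (forall j, j \in r -> pdeg k (f j)) -> pdeg k (fun x => \sum_(j <- r) f j x).
Proof.
elim: r => [|j r IH] fk.
  by apply: pdeg_eq (pdeg0 k) => x; rewrite big_nil.
apply: (@pdeg_eq _ (fun x => f j x + \sum_(j <- r) f j x)).
  by move=> x; rewrite big_cons.
by apply: pdegD; [|apply: IH => i ir]; apply: fk; rewrite inE ?eqxx ?ir ?orbT.
Qed.

Lemma pdeg_shift k f h : pdeg k f -> pdeg k (fun x => f (x + h)).
Proof.
elim: k f => [|k IH] f fk; first by move=> x; exact: fk.
by move=> h'; apply: pdeg_eq (IH _ (fk h')) => x; rewrite /diff addrAC.
Qed.

Lemma pdegS k f : pdeg k f -> pdeg k.+1 f.
Proof.
elim: k f => [|k IH] f fk h; last exact: IH.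
by move=> x; rewrite /diff !fk subr0.
Qed.

Lemma pdegW k l f : (k <= l)%N -> pdeg k f -> pdeg l f.
Proof.
by move=> /subnKC <-; elim: (l - k)%N => [|m IH]; rewrite ?addn0 // addnS => /IH/pdegS.
Qed.

(** Multiplying by an additive function raises the degree by at most one, by
    the product rule for differences. *)
Lemma pdeg_mull k (a : {additive G -> L}) f :
  pdeg k f -> pdeg k.+1 (fun x => a x * f x).
Proof.
elim: k f => [|k IH] f fk h.
  by move=> x; rewrite /diff !fk !mulr0 subr0.
apply: (@pdeg_eq k.+1 (fun x => a x * diff h f x + a h * f (x + h))).
  by move=> x; rewrite /diff raddfD; ring.
apply: pdegD; first exact: IH.
exact/pdegZ/pdeg_shift.
Qed.

Lemma diffsD hs f g x :
  diffs hs (fun x => f x + g x) x = diffs hs f x + diffs hs g x.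
Proof.
elim: hs f g => [|h hs IH] f g //=.
rewrite -[RHS]IH /diffs /=; congr (foldl _ _ _ _).
by apply/funext => y; rewrite /diff opprD addrACA.
Qed.

Lemma diffsZ hs c f x : diffs hs (fun x => c * f x) x = c * diffs hs f x.
Proof.
elim: hs f => [|h hs IH] f //=.
rewrite -[RHS]IH /diffs /=; congr (foldl _ _ _ _).
by apply/funext => y; rewrite /diff mulrBr.
Qed.

Lemma diffs_sum hs (J : Type) (r : seq J) (f : J -> G -> L) x :
  diffs hs (fun x => \sum_(j <- r) f j x) x = \sum_(j <- r) diffs hs (f j) x.
Proof.
elim: r => [|j r IH].
  rewrite big_nil (_ : (fun x => _) = fun x => 0 * (fun=> 0) x).
    by rewrite diffsZ mul0r.
  by apply/funext => y; rewrite big_nil mul0r.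
rewrite big_cons -IH -diffsD; congr (diffs _ _ _); apply/funext => y.
by rewrite big_cons.
Qed.

End DegreeCalculus.

Section Forms.
Variables (L : fieldType) (p : nat).
Hypothesis charL : p \in [pchar L].

Let p_prime : prime p. Proof. exact: pcharf_prime charL. Qed.

(** The monomial x^r with the exponent split into powers of p, which displays
    it as a product of additive functions. *)
Definition mono (s : seq nat) (x : L) : L := \prod_(i <- s) x ^+ (p ^ i).

Lemma monoE s x : mono s x = x ^+ (\sum_(i <- s) p ^ i)%N.
Proof. by rewrite /mono prodrXr. Qed.

Lemma frobD i (x y : L) : (x + y) ^+ (p ^ i) = x ^+ (p ^ i) + y ^+ (p ^ i).
Proof. by rewrite exprDn_pchar // pnatX pnatE // charL. Qed.

Lemma frobN i (x : L) : (- x) ^+ (p ^ i) = - x ^+ (p ^ i).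
Proof.
apply/eqP; rewrite -subr_eq0 opprK -frobD addNr expr0n expn_eq0.
by rewrite -leqn0 leqNgt prime_gt0.
Qed.

Lemma frobB i (x y : L) : (x - y) ^+ (p ^ i) = x ^+ (p ^ i) - y ^+ (p ^ i).
Proof. by rewrite frobD frobN. Qed.

(** The multilinear forms that arise by polarising monomials: the variables
    enter through their Frobenius powers, and the form is given by its
    coefficients on the exponent tuples. *)
Fixpoint form (I : nat) (A : seq nat -> L) (hs : seq L) : L :=
  if hs is h :: t then
    \sum_(i < I.+1) h ^+ (p ^ i) * form I (fun l => A (val i :: l)) t
  else A [::].

(** The coefficient at the tuple [l] of the form obtained by polarising
    [mono s]: the number of ways of matching [l] with [s]. *)
Fixpoint polar_coef (l s : seq nat) : L :=
  if l is i :: l' then (count_mem i s)%:R * polar_coef l' (rem i s)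
  else (s == [::])%:R.

Lemma eq_form I A A' hs :
  (forall l, size l = size hs -> A l = A' l) -> form I A hs = form I A' hs.
Proof.
elim: hs A A' => [|h t IH] A A' AA' /=; first exact: AA'.
apply: eq_bigr => i _; congr (_ * _); apply: IH => l lt.
by rewrite AA' //= lt.
Qed.

Lemma formZ I c A hs : form I (fun l => c * A l) hs = c * form I A hs.
Proof.
elim: hs A => [|h t IH] A //=; rewrite mulr_sumr.
by apply: eq_bigr => i _; rewrite IH mulrCA.
Qed.

Lemma formD I A A' hs :
  form I (fun l => A l + A' l) hs = form I A hs + form I A' hs.
Proof.
elim: hs A A' => [|h t IH] A A' //=; rewrite -big_split.
by apply: eq_bigr => i _; rewrite IH mulrDr.
Qed.

Lemma form_sum I (J : Type) (r : seq J) (A : J -> seq nat -> L) hs :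
  form I (fun l => \sum_(j <- r) A j l) hs = \sum_(j <- r) form I (A j) hs.
Proof.
elim: r => [|j r IH].
  rewrite big_nil -[RHS](mul0r (form I (fun=> 0) hs)) -formZ.
  by apply: eq_form => l _; rewrite big_nil mul0r.
rewrite big_cons -IH -formD; apply: eq_form => l _.
by rewrite big_cons.
Qed.

(** The form of [mono s] only involves rearrangements of [s], so its
    coefficients tell different exponents apart. *)
Lemma polar_coef_neq0 l s : polar_coef l s != 0 -> perm_eq l s.
Proof.
elim: l s => [|i l IH] s /=; first by case: s => //=; rewrite eqxx.
rewrite mulf_eq0 negb_or => /andP[c0 /IH ls].
have is_ : i \in s.
  by rewrite -has_pred1 has_count lt0n; apply: contraNneq c0 => ->.
by rewrite perm_sym (permPl (perm_to_rem is_)) perm_cons perm_sym.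
Qed.

(** The diagonal coefficient is the product of the factorials of the
    multiplicities, which does not vanish in characteristic p as long as the
    multiplicities are digits in base p. *)
Lemma polar_coef_diag s :
  (forall i, count_mem i s < p)%N -> polar_coef s s != 0.
Proof.
elim: s => [|i s IH] sp /=; first by rewrite oner_eq0.
rewrite eqxx mulf_neq0 ?IH //; last first.
  by move=> j; apply: leq_ltn_trans (sp j) => /=; rewrite leq_addl.
rewrite -(dvdn_pcharf charL) add1n; apply/negP => /dvdn_leq.
by have := sp i; rewrite /= eqxx add1n ltnNge => /negPf -> /(_ isT).
Qed.

Lemma sum_count (s : seq nat) I (f : nat -> L) : all (fun i => i <= I)%N s ->
  \sum_(i <- s) f i = \sum_(i < I.+1) (count_mem (val i) s)%:R * f i.
Proof.
elim: s => [|i s IH] /=; first by rewrite big_nil big1 // => i _; rewrite mul0r.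
move=> /andP[iI /IH E]; rewrite big_cons E.
under [RHS]eq_bigr do rewrite natrD mulrDl.
rewrite big_split /=; congr (_ + _).
rewrite (bigD1 (Ordinal (iI : i < I.+1)%N)) //= eqxx mul1r big1 ?addr0 //.
by move=> j ji; rewrite [_ == _](negbTE _) ?mul0r // eq_sym;
  apply: contraNneq ji => ?; apply/eqP/val_inj.
Qed.

Section Polarisation.
Variables (G : zmodType) (iota : {additive G -> L}).

Definition frob i (x : G) := iota x ^+ (p ^ i).

Lemma frob_is_additive i : zmod_morphism (frob i).
Proof. by move=> x y; rewrite /frob raddfB frobB. Qed.
HB.instance Definition _ i :=
  GRing.isZmodMorphism.Build G L (frob i) (frob_is_additive i).

Lemma mono_cons i s x : mono (i :: s) (iota x) = frob i x * mono s (iota x).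
Proof. by rewrite /mono big_cons. Qed.

Lemma mono_rem i s x : i \in s ->
  mono s x = x ^+ (p ^ i) * mono (rem i s) x.
Proof. by move=> /perm_to_rem P; rewrite /mono (perm_big _ P) big_cons. Qed.

Lemma pdeg_mono s : pdeg (size s).+1 (fun x => mono s (iota x)).
Proof.
elim: s => [|i s IH].
  by move=> h x; rewrite /diff /mono !big_nil subrr.
apply: pdeg_eq (pdeg_mull (frob i) IH) => x.
by rewrite mono_cons.
Qed.

(** Differencing a product of additive factors replaces each factor in turn
    by its increment, up to terms of lower degree. *)
Lemma diff_mono s h : exists2 R : G -> L, pdeg (size s).-1 R &
  forall x, diff h (fun x => mono s (iota x)) x =
    \sum_(i <- s) frob i h * mono (rem i s) (iota x) + R x.
Proof.
elim: s => [|i s [R Rs E]].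
  exists (fun=> 0) => // x.
  by rewrite /diff /mono !big_nil subrr addr0.
exists (fun x => frob i x * R x + frob i h * diff h (fun x => mono s (iota x)) x).
  rewrite /=; apply: pdegD; last exact/pdegZ/(pdeg_mono s h).
  case: s Rs {E} => [|j s] Rs /=; first by move=> x; rewrite Rs mulr0.
  exact: pdeg_mull.
move=> x; rewrite big_cons /= eqxx.
have -> : \sum_(j <- s) frob j h * mono (if i == j then s else i :: rem j s) (iota x)
  = frob i x * \sum_(j <- s) frob j h * mono (rem j s) (iota x).
  rewrite mulr_sumr; apply: eq_big_seq => j js; rewrite mulrCA; congr (_ * _).
  case: eqP => [->|_]; last by rewrite mono_cons.
  by rewrite (mono_rem _ js).
have -> : \sum_(j <- s) frob j h * mono (rem j s) (iota x) =
    diff h (fun x => mono s (iota x)) x - R x by rewrite E addrK.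
rewrite /diff !mono_cons raddfD /=; ring.
Qed.

(** Each difference removes one factor, so after as many differences as there
    are factors only the multilinear form is left. *)
Lemma diffs_mono I s hs x : all (fun i => i <= I)%N s -> size hs = size s ->
  diffs hs (fun x => mono s (iota x)) x = form I (polar_coef^~ s) (map iota hs).
Proof.
elim: hs s => [|h hs IH] s sI hss.
  by move/esym/size0nil: hss => ->; rewrite /diffs /mono /= big_nil.
have [R Rs E] := diff_mono s h.
transitivity (diffs hs
    (fun x => \sum_(i <- s) frob i h * mono (rem i s) (iota x) + R x) x).
  by rewrite /diffs /=; congr (foldl _ _ _ _); apply/funext.
rewrite diffsD diffs_sum (diffs_pdeg0 (f := R)) ?addr0; last by rewrite -hss in Rs.

transitivity (\sum_(i <- s) frob i h * form I (polar_coef^~ (rem i s)) (map iota hs)).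
  apply: eq_big_seq => i is_; rewrite diffsZ IH //.
    by apply/allP => j /mem_rem; move/allP: sI; apply.
  by rewrite size_rem // -hss.
rewrite (sum_count _ sI); apply: eq_bigr => i _.
by rewrite mulrCA -formZ.
Qed.

(** Translating the argument of a monomial changes only its lower-degree
    part. *)
Lemma pdeg_mono_shift s (c : L) :
  pdeg (size s) (fun x => mono s (c + iota x) - mono s (iota x)).
Proof.
suff : pdeg (size s) (fun x => mono s (c + iota x) - mono s (iota x)) /\
       pdeg (size s).+1 (fun x => mono s (c + iota x)) by case.
elim: s => [|i s [IH1 IH2]].
  split; first by move=> x; rewrite /mono !big_nil subrr.
  by move=> h x; rewrite /diff /mono !big_nil subrr.
have H : pdeg (size (i :: s)) (fun x => mono (i :: s) (c + iota x) - mono (i :: s) (iota x)).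
  apply: pdeg_eq (pdegD (pdeg_mull (frob i) IH1) (pdegZ (c ^+ (p ^ i)) IH2)) => x.
  rewrite /mono !big_cons frobD [X in X * _ + _]/= -/(frob i x).
  by rewrite mulrBr mulrDl addrAC [_ * _ + c ^+ _ * _]addrC.
split=> //; apply: pdeg_eq (pdegD (pdegS H) (pdeg_mono (i :: s))) => x.
by rewrite subrK.
Qed.

Lemma pdeg_mono_translate s (c : L) :
  pdeg (size s).+1 (fun x => mono s (c + iota x)).
Proof.
apply: pdeg_eq (pdegD (pdegS (pdeg_mono_shift s c)) (pdeg_mono s)) => x.
by rewrite subrK.
Qed.

End Polarisation.
End Forms.

(** * Diophantine approximation from one variable *)

Section PolyTimesLaurent.
Variable F : fieldType.
Implicit Types (a b : laurent F) (u v : {poly F}).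

Lemma lcoef_lpolyM v a (j : int) :
  lcoef (lpoly v * a) j = \sum_(i < size v) v`_i * lcoef a (j - i%:Z).
Proof.
rewrite lcoefM (@fsbigE _ _ _ _ _ [seq i%:Z | i <- iota 0 (size v)]) //.
- have -> : iota 0 (size v) = index_iota 0 (size v) by rewrite /index_iota subn0.
  rewrite big_map.
  rewrite (eq_bigl xpredT); last by move=> i; rewrite in_setT.
  by rewrite big_mkord.
- by rewrite map_inj_uniq ?iota_uniq // => i k [].
- move=> [i|i] _ ni /=; last by rewrite mul0r.
  rewrite nth_default ?mul0r // leqNgt; apply: contra ni => iv.
  by apply/mapP; exists i => //; rewrite mem_iota.
Qed.

Lemma lpoly_inj : injective (@lpoly F).
Proof.
move=> u v uv; apply/polyP => i.
exact: (congr1 (fun a => lcoef a i%:Z) uv).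
Qed.

Lemma lpoly_eq0 u : (lpoly u == 0) = (u == 0).
Proof. by rewrite -(inj_eq lpoly_inj) raddf0. Qed.

(** [small m a] says that a is within distance less than q^(-m) of F[t]. *)
Definition small m a := forall j, (j < m)%N -> lcoef a (Negz j) = 0.

Lemma smallW m n a : (n <= m)%N -> small m a -> small n a.
Proof. by move=> nm am j jn; apply: am; exact: leq_trans nm. Qed.

Lemma smallB m a b : small m a -> small m b -> small m (a - b).
Proof. by move=> am bm j jm; rewrite lcoefD lcoefN am // bm // subr0. Qed.

Lemma small_lpolyM m d v a :
  small m a -> (size v <= d.+1)%N -> small (m - d) (lpoly v * a).
Proof.
move=> am vd j jm; rewrite lcoef_lpolyM big1 // => i _.
have id_ : (i <= d)%N by rewrite -ltnS (leq_trans (ltn_ord i)).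
rewrite (_ : Negz j - i%:Z = Negz (j + i)); last by lia.
by rewrite am ?mulr0 //; lia.
Qed.

Lemma res_small m v a : small m a -> (size v <= m)%N -> res (lpoly v * a) = 0.
Proof.
move=> am vm; rewrite /res lcoef_lpolyM big1 // => i _.
rewrite (_ : - 1 - i%:Z = Negz i); last by lia.
by rewrite am ?mulr0 // (leq_trans (ltn_ord i)).
Qed.

Lemma notsmall_first M a : ~ small M a ->
  exists2 s, (s < M)%N & small s a /\ lcoef a (Negz s) != 0.
Proof.
move=> nM.
have ex : exists s, (s < M)%N && (lcoef a (Negz s) != 0).
  apply/not_existsP => H; apply: nM => j jM; apply/eqP.
  by have := H j; rewrite jM /= => /negP; rewrite negbK.
case: (ex_minnP ex) => s /andP[sM a0] smin; exists s => //; split=> // j js.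
apply/eqP/negP => /negP aj; have := smin j.
by rewrite (ltn_trans js sM) aj leqNgt js => /(_ isT).
Qed.

(** Below t^0 the product is governed by the lowest-order data on both sides:
    the first nonzero coefficient of a moves up by the degree of v. *)
Lemma lcoef_lpolyM_first s v a : small s a -> v != 0 -> ((size v).-1 <= s)%N ->
  lcoef (lpoly v * a) (Negz (s - (size v).-1)) =
    lead_coef v * lcoef a (Negz s).
Proof.
move=> sa v0 vs; rewrite lcoef_lpolyM.
rewrite lead_coefE; set D := (size v).-1 in vs *.
have -> : size v = D.+1 by rewrite prednK // size_poly_gt0.
rewrite big_ord_recr /= big1 ?add0r => [|i _]; last first.
  have -> : Negz (s - D) - i%:Z = Negz (s - D + i) by lia.
  by rewrite sa ?mulr0 //; have := ltn_ord i; lia.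
by have -> : Negz (s - D) - D%:Z = Negz s by lia.
Qed.

End PolyTimesLaurent.

Section SingleVariable.
Variable F : finFieldType.
Variable p : nat.
Hypothesis charF : p \in [pchar F].
Local Notation q := #|F|.

Lemma pcharLaurent : p \in [pchar (laurent F)].
Proof.
have /andP[pp p0] := charF; apply/andP; split => //.
rewrite -(rmorph_nat (@lpoly F)) lpoly_eq0 -polyC_natr polyC_eq0.
exact: p0.
Qed.

(** A set of density q^(-k) has two elements whose difference is a multiple of
    [v * 'X^d] with cofactor of degree at most k: the translates of the set by
    the q^(k+1) such multiples cannot be disjoint. *)
Lemma difference_in_window n k d (v : {poly F}) (X : {set {poly_n F}}) :
  v != 0 -> (size v + d + k <= n)%N -> (q ^ n <= #|X| * q ^ k)%N ->
  exists2 u : {poly F}, u != 0 /\ (size u <= k.+1)%N &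
    exists x y, [/\ x \in X, y \in X & val x - val y = v * 'X^d * u].
Proof.
move=> v0 vn Xk; pose T (u : {poly_k.+1 F}) := npolyp n (v * 'X^d * val u).
have Tval u : val (T u) = v * 'X^d * val u.
  rewrite /T /= npolypK //; have [->|u0] := eqVneq (val u) 0.
    by rewrite mulr0 size_poly0.
  have X0 : 'X^d != 0 :> {poly F} by rewrite monic_neq0 ?monicXn.
  rewrite size_mul ?mulf_neq0 // size_mul // size_polyXn.
  by move: (size_npoly u) => /=; set a := size v; set b := size _; lia.
pose f (xu : {poly_n F} * {poly_k.+1 F}) := xu.1 + T xu.2.
have : ~ {in finset.setX X [set: {poly_k.+1 F}]%SET &, injective f}.
  move=> /card_in_imset E; have := max_card (mem (f @: finset.setX X [set: {poly_k.+1 F}]%SET)).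
  rewrite E cardsX cardsT !qpoly.card_npoly expnS mulnCA => H.
  have q1 : (1 < q)%N := finNzRing_gt1 F.
  have : (q * q ^ n <= q ^ n)%N by apply: leq_trans H; rewrite leq_mul2l Xk orbT.
  by rewrite -{2}(mul1n (q ^ n)%N) leq_mul2r expn_eq0 -[(q == 0)%N]negbK -lt0n; lia.
move=> /existsNP[[x u]] /existsNP[[y w]] /not_implyP[] /setXP[/= xX _].
move=> /not_implyP[] /setXP[/= yX _] /not_implyP[fxy ne].
have E : val x - val y = v * 'X^d * (val w - val u).
  have /(congr1 val) := fxy; rewrite /f !raddfD /= -!/(val _) !Tval => fxy'.
  rewrite mulrBr; apply/eqP; rewrite subr_eq addrAC eq_sym subr_eq eq_sym.
  by rewrite fxy' addrC.
exists (val w - val u); last by exists x, y.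
split; last exact: size_npoly (w - u).
rewrite subr_eq0; apply/eqP => wu; apply: ne.
have -> : u = w by apply/val_inj.
by congr (_, _); apply/val_inj/eqP; rewrite -subr_eq0 E wu subrr mulr0.
Qed.

(** Write e = p^i; the condition on x only depends on x^e additively.  One
    denominator u^e comes from a difference u of small degree.  Multiplying by
    the e-th power of a further polynomial v 'X^d, for which u v 'X^d is again
    a difference, would move the first nonzero coefficient of (u^e) a below t^0
    into the range where all coefficients vanish, unless that coefficient lies
    as deep as claimed. *)
Lemma small_of_dense n k m i (a : laurent F) (X : {set {poly_n F}}) :
  (q ^ n <= #|X| * q ^ k)%N -> (2 * k + 2 <= n)%N -> (p ^ i * k.+1 <= m)%N ->
  (forall x, x \in X -> small m (lpoly (val x ^+ (p ^ i)) * a)) ->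
  exists2 u : {poly F}, u != 0 /\ (size u <= k.+1)%N &
    small (m + p ^ i * (n - (2 * k + 2))) (lpoly (u ^+ (p ^ i)) * a).
Proof.
move=> Xk kn; set e := (p ^ i)%N => km aX.
have e0 : (0 < e)%N by rewrite expn_gt0 prime_gt0 // (pcharf_prime charF).
have aXB x y : x \in X -> y \in X -> small m (lpoly ((val x - val y) ^+ e) * a).
  move=> xX yX; rewrite rmorphXn rmorphB /= (frobB pcharLaurent) mulrBl.
  by apply: smallB; rewrite -rmorphXn; exact: aX.
(* d = 0 and v = 1: a difference of degree at most k *)
have [u [u0 uk] [x [y [xX yX xy]]]] :=
  @difference_in_window n k 0 1 X (oner_neq0 _) ltac:(rewrite size_poly1; lia) Xk.
rewrite expr0 !mul1r in xy; exists u => //.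
set b := lpoly _ * a.
apply: contrapT => /notsmall_first[s sM [sb b0]].
have ms : (m <= s)%N.
  rewrite leqNgt; apply/negP => sm; move/eqP: b0; apply.
  by have := aXB _ _ xX yX; rewrite xy => /(_ _ sm).
(* the least d with d * e > s - m *)
pose d := ((s - m + e) %/ e)%N.
have d1 : (s - m < d * e)%N.
  by have := ltn_ceil (s - m + e) e0; rewrite -/d; lia.
have d2 : (d * e <= s - m + e)%N by exact: leq_divM.
have dn : (d <= n - (2 * k + 2))%N.
  by rewrite -ltnS /d ltn_divLR // mulSn mulnC; lia.
have [v [v0 vk] [x' [y' [xX' yX' xy']]]] :=
  @difference_in_window n k d u X u0 ltac:(lia) Xk.
have := aXB _ _ xX' yX'; rewrite xy' -mulrA exprMn_comm; last exact: mulrC.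
rewrite [u ^+ e * _]mulrC rmorphM /= -mulrA -/b => small_b.
have w0 : ('X^d * v) ^+ e != 0.
  by rewrite expf_neq0 // mulf_neq0 // monic_neq0 ?monicXn.
have sw : (size (('X^d * v) ^+ e)).-1 = ((d + (size v).-1) * e)%N.
  rewrite size_exp size_mul //; last by rewrite monic_neq0 ?monicXn.
  rewrite size_polyXn.
  by move: v0; rewrite -size_poly_gt0; case: (size v) => // z _; rewrite addSn addnS.
set D := ((d + (size v).-1) * e)%N in sw *.
have D1 : (d * e <= D)%N by rewrite leq_mul2r leq_addr orbT.
have D2 : (D <= d * e + k * e)%N.
  by rewrite -mulnDl leq_mul2r leq_add2l; apply/orP; right; lia.
clearbody D d; move: km; rewrite mulnS [(e * k)%N]mulnC => km'.
have Ds : (D <= s)%N by clear -D2 d2 km' ms; lia.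
have Dm : (s - D < m)%N by clear -D1 d1 km' e0; lia.
have := lcoef_lpolyM_first sb w0; rewrite sw small_b //.
move=> /(_ Ds)/esym/eqP; rewrite mulf_eq0 lead_coef_eq0 (negPf w0).
by rewrite (negPf b0).
Qed.

End SingleVariable.

(** * Diophantine approximation from several variables *)

Section Pigeonhole.
Variables (C : numFieldType) (G : finType).

Lemma pigeonhole (H : finType) (X : {set G}) (P : G -> H -> bool) :
  (forall x, x \in X -> exists h, P x h) -> (0 < #|X|)%N ->
  exists h : H, (#|X| <= #|H| * #|[set x in X | P x h]%SET|)%N.
Proof.
move=> XP X0; apply/not_existsP => N.
have H0 : (0 < #|H|)%N.
  by case/card_gt0P: X0 => x /XP[h _]; apply/card_gt0P; exists h.
have le1 : (#|X| <= \sum_(h : H) #|[set x in X | P x h]%SET|)%N.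
  under eq_bigr do rewrite -sum1_card.
  rewrite (exchange_big_dep (mem X)) /=; last by move=> h x _; rewrite inE => /andP[].
  rewrite -sum1_card; apply: leq_sum => x xX; have [h xh] := XP x xX.
  by rewrite (bigD1 h) //= inE xX.
have le2 : (\sum_(h : H) (#|H| * #|[set x in X | P x h]%SET|) <= \sum_(h : H) #|X|.-1)%N.
  by apply: leq_sum => h _; have /negP := N h; rewrite -ltnNge; lia.
move: le2; rewrite -big_distrr /= sum_nat_const leq_pmul2l // leqNgt.
by move/negP; apply; apply: leq_trans le1; rewrite prednK.
Qed.

(** A mean of size q^(-k) of a function bounded by 1 cannot come from values
    below q^(-k-1) alone. *)
Lemma popular_set (f : G -> C) (q k : nat) : (1 < q)%N ->
  (forall x, 0 <= f x <= 1) -> (q%:R ^+ k)^-1 <= mean f ->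
  (#|G| <= #|[set x | ((q%:R ^+ k.+1)^-1 <= f x)%R]%SET| * q ^ k.+1)%N.
Proof.
move=> q1 f01; set d : C := (_ ^+ k.+1)^-1; set X := [set x | _]%SET => fk.
have q0 : 0 < q%:R :> C by rewrite ltr0n; lia.
have d0 : 0 < d by rewrite invr_gt0 exprn_gt0.
have [->//|G0] := posnP #|G|.
have G0' : 0 < #|G|%:R :> C by rewrite ltr0n.
rewrite -(ler_nat C) natrM natrX.
have le1 : \sum_x f x <= #|X|%:R + d * #|G|%:R.
  apply: le_trans (_ : \sum_x ((x \in X)%:R + d) <= _).
    apply: ler_sum => x _; have /andP[f0 f1] := f01 x.
    have [xX|] := boolP (x \in X); first by rewrite -[leLHS]addr0 lerD // ltW.
    rewrite inE => nX; have fd : f x < d.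
      by rewrite real_ltNge // ger0_real // ltW.
    by rewrite mulr0n add0r ltW.
  rewrite big_split /= sumr_const -(mulr_natr d) lerD2r -natr_sum ler_nat.
  by rewrite -sum1_card [leqRHS]big_mkcond leq_sum // => x _; case: (x \in X).
move: fk; rewrite /mean ler_pdivlMr // => fk.
have {}fk := le_trans fk le1.
have qd : (q%:R ^+ k)^-1 = q%:R * d.
  by rewrite /d exprS invfM mulrA mulfV ?mul1r // gt_eqF.
rewrite qd -lerBlDr -mulrBl in fk.
have : d * #|G|%:R <= #|X|%:R.
  apply: le_trans fk; rewrite ler_wpM2r ?ler0n //.
  by rewrite lerBrDr -mulr2n -(mulr_natl d) ler_wpM2r ?(ltW d0) // ler_nat.
by rewrite /d mulrC ler_pdivrMr ?exprn_gt0.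
Qed.
End Pigeonhole.

Definition pow_prod (F : nzRingType) p (es : seq nat) (hs : seq {poly F}) :=
  \prod_(x <- zip hs es) x.1 ^+ (p ^ x.2).

(** Peeling off the variables one at a time: for many values of the first
    variable the remaining ones produce a denominator, some denominator is
    produced equally often up to a factor q^(O(k)), and the dependence on the
    first variable then improves the approximation. *)
Lemma small_of_dense_multi (p : nat) (es : seq nat) : exists c : nat,
  forall (F : finFieldType) (C : numFieldType), p \in [pchar F] ->
  forall (n k m : nat) (a : laurent F),
  (c * k.+1 <= n)%N -> (c * k.+1 <= m)%N ->
  (#|F|%:R ^+ k)^-1 <= avg (size es) (fun hs : seq {poly_n F} =>
    (`[< small m (lpoly (pow_prod p es (map val hs)) * a) >])%:R) :> C ->
  exists2 g : {poly F}, g != 0 /\ (size g <= c * k.+1)%N &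
    small (m + n * (\sum_(i <- es) p ^ i) - c * k.+1) (lpoly g * a).
Proof.
elim: es => [|i es [c IH]].
  exists 1%N => F C charF n k m a _ _ /=.
  case: asboolP => [am _|_].
    exists 1; first by rewrite oner_eq0 size_poly1.
    move: am; rewrite /pow_prod big_nil big_nil muln0 addn0; apply: smallW.
    exact: leq_subr.
  have q0 : 0 < (#|F|%:R ^+ k)^-1 :> C.
    by rewrite invr_gt0 exprn_gt0 // ltr0n ltnW // finNzRing_gt1.
  by rewrite mulr0n => /(lt_le_trans q0); rewrite ltxx.
pose e := (p ^ i)%N; pose c' := (2 * c + (e + 1) * (4 + 4 * c))%N.
exists c' => F C charF n k m a cn cm avg_ge.
set q := #|F| in avg_ge *; have q1 : (1 < q)%N := finNzRing_gt1 F.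
have e0 : (0 < e)%N by rewrite expn_gt0 prime_gt0 // (pcharf_prime charF).
pose ind (h : {poly_n F}) (hs : seq {poly_n F}) : C :=
  (`[< small m (lpoly (pow_prod p es (map val hs)) * (lpoly (val h ^+ e) * a)) >])%:R.
pose f h := avg (size es) (ind h).
have fk : (q%:R ^+ k)^-1 <= mean f.
  apply: le_trans avg_ge _; rewrite /= /f; apply: le_mean => h.
  apply: le_avg => l _; apply: le_indic.
  by rewrite /pow_prod /= big_cons rmorphM -mulrA mulrCA.
have f01 h : 0 <= f h <= 1.
  rewrite avg_ge0 => [|l]; last by rewrite ler0n.
  have <- : avg (size es) (fun _ : seq {poly_n F} => 1 : C) = 1.
    elim: (size es) => //= z ->; apply: mean_cst.
    by apply/card_gt0P; exists 0.
  by apply: le_avg => l _; rewrite lern1 leq_b1.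
have := popular_set q1 f01 fk; set X := [set x | _]%SET => Xk.
(* bound for the size of the denominators given by induction, at loss k + 1 *)
pose Gam := (c * k.+2)%N.
pose M := (m + n * (\sum_(i <- es) p ^ i) - Gam)%N.
have Gc : (Gam <= c' * k.+1)%N by rewrite /Gam /c'; nia.
pose P (h : {poly_n F}) (g : {poly_Gam F}) :=
  (val g != 0) && `[< small M (lpoly (val g) * (lpoly (val h ^+ e) * a)) >].
have XP h : h \in X -> exists g, P h g.
  rewrite inE => /IH - /(_ charF (leq_trans Gc cn) (leq_trans Gc cm)).
  move=> [g [g0 gs] gM]; exists (npolyp Gam g); rewrite /P /= npolypK //.
  by rewrite g0; exact/asboolP.
have X0 : (0 < #|X|)%N.
  rewrite lt0n; apply: contraTneq Xk => ->.
  by rewrite mul0n -ltnNge qpoly.card_npoly expn_gt0 ltnW.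
have [g] := pigeonhole XP X0; rewrite qpoly.card_npoly -/q; set Y := [set x in X | _]%SET.
(* the loss after fixing the denominator: its q^Gam choices cost a further Gam *)
move=> Yk; pose k' := (Gam + k.+1)%N.
have Yk' : (q ^ n <= #|Y| * q ^ k')%N.
  rewrite -qpoly.card_npoly; apply: leq_trans Xk _.
  by rewrite /k' expnD mulnA leq_mul2r [(#|Y| * _)%N]mulnC Yk orbT.
have [y] : exists y, y \in Y.
  apply/card_gt0P; rewrite lt0n; apply: contraTneq Yk' => ->.
  by rewrite mul0n -ltnNge expn_gt0 ltnW.
rewrite !inE => /andP[_ /andP[g0 _]].
have YM h : h \in Y -> small M (lpoly (val h ^+ (p ^ i)) * (lpoly (val g) * a)).
  by rewrite !inE mulrCA => /andP[_ /andP[_ /asboolP]].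
have k'n : (2 * k' + 2 <= c' * k.+1)%N by rewrite /k' /Gam /c'; nia.
have k'M : (p ^ i * k'.+1 + Gam <= c' * k.+1)%N by rewrite -/e /k' /Gam /c'; nia.
have := small_of_dense charF Yk' (leq_trans k'n cn) _ YM.
have -> : (p ^ i * k'.+1 <= M)%N by rewrite /M; lia.
move=> /(_ isT)[u [u0 uk] uM]; exists (u ^+ (p ^ i) * val g).
  split; first by rewrite mulf_neq0 // expf_neq0.
  apply: leq_trans (size_polyMleq _ _) _.
  have gs : (size (val g) <= Gam)%N := size_npoly g.
  have us : (size (u ^+ (p ^ i)) <= k' * e + 1)%N.
    apply: leq_trans (size_poly_exp_leq _ _) _.
    by rewrite -/e addn1 ltnS leq_mul2r; apply/orP; right; lia.
  move: k'M gs us => /=; rewrite -/e mulnS [(e * k')%N]mulnC.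
  set A := size _; set B := size _; clear; lia.
rewrite rmorphM /= -mulrA; apply: smallW uM; rewrite big_cons -/e.
rewrite /M; set E := (\sum_(j <- es) p ^ j)%N; set T := (2 * k' + 2)%N.
have GT : (Gam + e * T <= c' * k.+1)%N.
  have Gz : (Gam <= 2 * c * k.+1)%N by rewrite /Gam; clear; nia.
  have Tz : (T <= (4 + 4 * c) * k.+1)%N by rewrite /T /k' /Gam; clear; nia.
  have eTz : (e * T <= e * ((4 + 4 * c) * k.+1))%N by rewrite leq_mul2l Tz orbT.
  apply: leq_trans (leq_add Gz eTz) _; rewrite /c' [leqRHS]mulnDl leq_add2l mulnA.
  by rewrite !leq_mul2r leq_addr !orbT.
have eT : (e * T <= e * n)%N by rewrite leq_mul2l (leq_trans k'n cn) orbT.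
rewrite mulnBr mulnDr [(n * e)%N]mulnC.
have := leq_trans Gc cm.
clearbody E T Gam c' e; clear -GT eT; lia.
Qed.

(** * Sets of tuples with subgroups as fibres *)

Fixpoint upd (T : Type) j (g : T -> T) (s : seq T) : seq T :=
  if s is h :: t then if j is j'.+1 then h :: upd j' g t else g h :: t
  else [::].

Section FibrewiseSubgroups.
Variables (C : numFieldType) (G X : finZmodType).
Variables (T1 T2 : {additive X -> G}).
Hypothesis T1_inj : injective T1.

(** Among the simultaneous translates of the two conditions some holds for
    at least the expected number of x, and differences move that number to
    the untranslated conditions. *)
Lemma card_two_preimages (H : {set G}) :
  (forall x y, x \in H -> y \in H -> x - y \in H) ->
  (#|X| * #|H| ^ 2 <= #|G| ^ 2 * #|[set x | (T1 x \in H) && (T2 x \in H)]%SET|)%N.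
Proof.
move=> HB; pose N u v := #|[set x | (T1 x + u \in H) && (T2 x + v \in H)]%SET|.
have shift (T : X -> G) x : (\sum_(u : G) ((T x + u)%R \in H))%N = #|H|.
  rewrite (reindex_inj (addrI (- T x))) /= -sum1_card [RHS]big_mkcond /=.
  by apply: eq_bigr => u _; rewrite addNKr; case: (u \in H).
have sumN : (\sum_u \sum_v N u v = #|X| * #|H| ^ 2)%N.
  transitivity (\sum_(x : X) \sum_u \sum_v ((T1 x + u)%R \in H) * ((T2 x + v)%R \in H))%N.
    rewrite [RHS]exchange_big /=; apply: eq_bigr => u _.
    rewrite [RHS]exchange_big /=; apply: eq_bigr => v _.
    rewrite /N -sum1_card big_mkcond /=; apply: eq_bigr => x _.
    by rewrite inE; case: (_ \in H); case: (_ \in H).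
  under eq_bigr => x _ do [under eq_bigr => u _ do rewrite -big_distrr /= shift;
    rewrite -big_distrl /= shift].
  by rewrite sum_nat_const mulnn.
have leN u v : (N u v <= N 0%R 0%R)%N.
  rewrite /N; set S := finset _; set S0 := finset _.
  have [->|[x0 x0S]] := set_0Vmem S; first by rewrite cards0.
  rewrite -(card_imset (mem S) (subIr x0)); apply/subset_leq_card/fintype.subsetP.
  move=> _ /imsetP[x xS ->]; move: x0S xS; rewrite !inE => /andP[a b] /andP[c d].
  rewrite !addr0 !raddfB /=; apply/andP; split.
    by have := HB _ _ c a; rewrite opprD addrACA subrr addr0.
  by have := HB _ _ d b; rewrite opprD addrACA subrr addr0.
have -> : #|[set x | (T1 x \in H) && (T2 x \in H)]%SET| = N 0%R 0%R.
  by apply: eq_card => x; rewrite !inE !addr0.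
rewrite -sumN; apply: leq_trans (_ : (\sum_(u : G) \sum_(v : G) N 0%R 0%R <= _)%N).
  by apply: leq_sum => u _; apply: leq_sum.
by rewrite !sum_nat_const mulnA mulnn.
Qed.

(** In a set of tuples coming from a multilinear condition each coordinate,
    with the others fixed, ranges over a subgroup. *)
Definition fibre_closed k j (B : seq G -> Prop) := forall l x y, size l = k ->
  B (upd j (fun=> x) l) -> B (upd j (fun=> y) l) ->
  B (upd j (fun=> x - y) l).

(** T1 is meant to be an inclusion and T2 a scaling, both defined on the
    smaller space of entries that still fit after scaling. *)
Definition pulled j (B : seq G -> Prop) (l : seq G) :=
  B l /\ exists2 x, nth 0 l j = T1 x & B (upd j (fun=> T2 x) l).

(** In every fibre the density is at worst squared, up to the density of the
    domain of T1, and the mean of the squares is at least the square of the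
    mean. *)
Lemma avg_pulled k j (B : seq G -> Prop) : (j < k)%N -> fibre_closed k j B ->
  #|X|%:R / #|G|%:R * avg k (fun l => (`[< B l >])%:R : C) ^+ 2 <=
  avg k (fun l => (`[< pulled j B l >])%:R : C).
Proof.
have G0 : (0 < #|G|)%N by apply/card_gt0P; exists 0.
have G0' : 0 < #|G|%:R :> C by rewrite ltr0n.
have r0 : 0 <= #|X|%:R / #|G|%:R :> C by rewrite divr_ge0 ?ler0n.
elim: k j B => // k IH [|j] B jk Bc /=; last first.
  apply: le_trans (_ : mean (fun h => #|X|%:R / #|G|%:R *
      avg k (fun l => (`[< B (h :: l) >])%:R : C) ^+ 2) <= _).
    rewrite meanZ; apply: ler_wpM2l => //; apply: mean_sqr => // h.
    by apply: avg_ge0 => l; rewrite ler0n.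
  apply: le_mean => h; apply: le_trans (IH j (fun l => B (h :: l)) jk _) _.
    by move=> l x y lk; apply: (Bc (h :: l) x y); rewrite /= lk.
  exact: lexx.
rewrite !mean_avgC.
apply: le_trans (_ : avg k (fun l => #|X|%:R / #|G|%:R *
    mean (fun h => (`[< B (h :: l) >])%:R : C) ^+ 2) <= _).
  rewrite avgZ; apply: ler_wpM2l => //; apply: avg_sqr => // l.
  by apply: mean_ge0 => h; rewrite ler0n.
apply: le_avg => l lk; pose H := [set h | `[< B (h :: l) >]]%SET.
have := @card_two_preimages H; set S := finset _ => cardH.
have meanE (Q : pred G) : mean (fun h => (Q h)%:R : C) = #|Q|%:R / #|G|%:R.
  rewrite /mean -natr_sum; congr (_%:R / _); rewrite -sum1_card [RHS]big_mkcond.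
  by apply: eq_bigr => h _; rewrite unfold_in; case: (Q h).
have -> : mean (fun h => (`[< B (h :: l) >])%:R : C) = #|H|%:R / #|G|%:R.
  by rewrite meanE /H cardsE.
rewrite meanE expr_div_n mulf_div ler_pdivrMr; last by rewrite mulr_gt0 ?exprn_gt0.
rewrite [leRHS]mulrA mulfVK ?gt_eqF // -!natrX -!natrM ler_nat.
have HB x y : x \in H -> y \in H -> x - y \in H.
  rewrite !inE => Bx By.
  have sl : size (0 :: l) = k.+1 by rewrite /= lk.
  exact: (Bc _ x y sl Bx By).
apply: leq_trans (cardH HB) _; rewrite mulnC leq_mul2r; apply/orP; right.
rewrite -(card_imset (mem S) T1_inj); apply/subset_leq_card/fintype.subsetP.
move=> y /imsetP[x xS ->{y}]; move: xS; rewrite finset.inE => /andP[].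
rewrite !finset.inE => /asboolP B1 /asboolP B2.
by apply: asboolT; split => //; exists x.
Qed.

End FibrewiseSubgroups.

Section FormUpdates.
Variables (L : fieldType) (p : nat).
Hypothesis charL : p \in [pchar L].

Lemma form_upd_scale I (A : seq nat -> L) c j hs : (j < size hs)%N ->
  form p I A (upd j (fun h => c * h) hs) =
  form p I (fun l => c ^+ (p ^ nth 0%N l j) * A l) hs.
Proof.
elim: hs j A => [|h t IH] [|j] A //= jt; apply: eq_bigr => i _.
  by rewrite formZ exprMn -mulrA mulrCA.
by rewrite IH.
Qed.

Lemma form_updB I (A : seq nat -> L) x y j hs : (j < size hs)%N ->
  form p I A (upd j (fun=> x - y) hs) =
  form p I A (upd j (fun=> x) hs) - form p I A (upd j (fun=> y) hs).
Proof.
elim: hs j A => [|h t IH] [|j] A //= jt; rewrite -sumrB; apply: eq_bigr => i _.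
  by rewrite (frobB charL) mulrBl.
by rewrite IH // mulrBr.
Qed.

Lemma form_single I (A : seq nat -> L) l0 hs : size l0 = size hs ->
  all (fun i => i <= I)%N l0 ->
  (forall l, size l = size hs -> all (fun i => i <= I)%N l -> l != l0 -> A l = 0) ->
  form p I A hs = A l0 * \prod_(x <- zip hs l0) x.1 ^+ (p ^ x.2).
Proof.
elim: hs l0 A => [|h t IH] [|i0 l0] A //=.
  by rewrite big_nil mulr1.
move=> [sl] /andP[i0I l0I] A0; rewrite big_cons /=.
rewrite (bigD1 (Ordinal (i0I : (i0 < I.+1)%N))) //= (IH l0) //; last first.
  by move=> l lt lI ll0; apply: A0; rewrite /= ?lt ?i0I // eqseq_cons negb_and ll0 orbT.
rewrite mulrCA [X in _ + X]big1 ?addr0 // => i ii0.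
have Ai l : size l = size t -> all (fun i => i <= I)%N l -> A (val i :: l) = 0.
  move=> lt lI; apply: A0; rewrite /= ?lt ?lI ?andbT -1?ltnS //.
  by rewrite eqseq_cons negb_and; apply/orP; left; apply: contra ii0 => /eqP ?; apply/eqP/val_inj.
rewrite (IH l0 (fun l => A (val i :: l)) sl l0I) => [|l lt lI _]; last exact: Ai.
by rewrite (Ai l0 sl l0I) mul0r mulr0.
Qed.

End FormUpdates.

(** * Twisting forms by powers of t *)

(** The properties of the additive character on the completed field that the
    argument uses: it factors through the residue, and no nonzero residue is
    annihilated together with all its multiples by constants. *)
Definition residue_character (C : numClosedFieldType) (F : fieldType)
    (e : laurent F -> C) :=
  [/\ forall a b, e (a + b) = e a * e b, forall a, `|e a| = 1,
      forall a, res a = 0 -> e a = 1 &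
      forall a, (forall c : F, e (lpoly c%:P * a) = 1) -> res a = 0].

Section NpolyMaps.
Variable F : finFieldType.

Definition iota_npoly n (x : {poly_n F}) : laurent F := lpoly (val x).

Fact iota_npoly_is_additive n : zmod_morphism (@iota_npoly n).
Proof. by move=> x y; rewrite /iota_npoly !raddfB. Qed.
HB.instance Definition _ n := GRing.isZmodMorphism.Build {poly_n F} (laurent F)
  (@iota_npoly n) (@iota_npoly_is_additive n).

Definition mul_npoly k n (v : {poly F}) (x : {poly_k F}) : {poly_n F} :=
  npolyp n (v * val x).

Fact mul_npoly_is_additive k n v : zmod_morphism (@mul_npoly k n v).
Proof.
move=> x y; apply/npolyP => i; rewrite coef_npolyp raddfB /= coefB !coef_npolyp.
by rewrite mulrBr coefB; case: ifP => // _; rewrite subr0.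
Qed.
HB.instance Definition _ k n v :=
  GRing.isZmodMorphism.Build {poly_k F} {poly_n F} (@mul_npoly k n v)
    (@mul_npoly_is_additive k n v).

Lemma val_mul_npoly k n (v : {poly F}) (x : {poly_k F}) :
  (size v + k <= n.+1)%N -> v != 0 -> val (mul_npoly n v x) = v * val x.
Proof.
move=> vn v0; rewrite /= npolypK //; have [->|x0] := eqVneq (val x) 0.
  by rewrite mulr0 size_poly0.
rewrite size_mul //.
by move: vn (size_npoly x) => /=; set a := size v; set b := size _; lia.
Qed.

Lemma mul_Xn_npoly n P (x : {poly_(n - P) F}) :
  val (mul_npoly n 'X^P x) = 'X^P * val x.
Proof.
have [Pn|nP] := leqP P n.
  by rewrite val_mul_npoly ?monic_neq0 ?monicXn // size_polyXn; lia.
have x0 : val x = 0.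
  apply/eqP; rewrite -size_poly_eq0 -leqn0.
  by apply: leq_trans (size_npoly x) _; lia.
by rewrite /mul_npoly x0 mulr0 [LHS]npolypK ?size_poly0.
Qed.

Lemma inclusion_npoly n P (x : {poly_(n - P) F}) : val (mul_npoly n 1 x) = val x.
Proof.
by rewrite val_mul_npoly ?mul1r ?oner_neq0 // size_poly1; lia.
Qed.

End NpolyMaps.

Section SmallOfCharacter.
Variables (F : finFieldType) (C : numClosedFieldType) (e : laurent F -> C).
Hypothesis e_char : residue_character e.

(** Testing against the multiples of t^j by constants detects the coefficient
    of t^(-j-1). *)
Lemma small_of_character m (a : laurent F) :
  (forall y : {poly F}, (size y <= m)%N -> e (lpoly y * a) = 1) -> small m a.
Proof.
move=> ea j jm.
have -> : lcoef a (Negz j) = res (lpoly 'X^j * a).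
  rewrite /res lcoef_lpolyM size_polyXn big_ord_recr /= big1 ?add0r => [|i _].
    by rewrite coefXn eqxx mul1r; congr (lcoef a _); lia.
  by rewrite coefXn ltn_eqF ?mul0r //= (ltn_ord i).
case: e_char => _ _ _; apply => c; rewrite mulrA -rmorphM; apply: ea.
by rewrite mul_polyC (leq_trans (size_scale_leq _ _)) // size_polyXn.
Qed.

End SmallOfCharacter.

Section Twisting.
Variables (F : finFieldType) (p : nat).
Hypothesis charF : p \in [pchar F].
Variables (C : numClosedFieldType) (e : laurent F -> C).
Hypothesis e_char : residue_character e.
Variables (I n : nat).
Local Notation q := #|F|.

Let charL : p \in [pchar (laurent F)] := pcharLaurent charF.

Let eD a b : e (a + b) = e a * e b. Proof. by case: e_char. Qed.
Let e_norm a : `|e a| = 1. Proof. by case: e_char. Qed.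
Let eB a b : e a = 1 -> e b = 1 -> e (a - b) = 1.
Proof. by move=> ea eb; rewrite eD ea (characterN eD e_norm) eb conjC1 mulr1. Qed.

(** The first variable stands apart: it ranges over all polynomials of size at
    most [m], a bound that shrinks under the operations below, while the other
    variables keep running over the space on which means are taken. *)
Definition kills (A : seq nat -> laurent F) m (hs : seq {poly_n F}) :=
  forall y : {poly F}, (size y <= m)%N ->
    e (form p I A (lpoly y :: map (@iota_npoly F n) hs)) = 1.

Definition twist_weight j b (l : seq nat) : {poly F} :=
  'X^(p ^ I * p ^ nth 0%N l j.+1) - 'X^(p ^ b * p ^ nth 0%N l 0).

Definition twist j b (A : seq nat -> laurent F) l :=
  lpoly (twist_weight j b l) * A l.

Lemma map_upd j c (hs : seq {poly_n F}) (x y : {poly_n F}) :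
  iota_npoly y = c * iota_npoly x -> nth 0 hs j = x ->
  map (@iota_npoly F n) (upd j (fun=> y) hs) =
  upd j (fun h => c * h) (map (@iota_npoly F n) hs).
Proof.
move=> yx; elim: hs j => [|h t IH] [|j] //= hx; first by rewrite yx hx.
by rewrite IH.
Qed.

Lemma upd_const j (hs : seq {poly_n F}) x :
  map (@iota_npoly F n) (upd j (fun=> x) hs) =
  upd j (fun=> iota_npoly x) (map (@iota_npoly F n) hs).
Proof. by elim: hs j => [|h t IH] [|j] //=; rewrite IH. Qed.

(** Scaling the j-th variable by t^(p^I) and the first one by t^(p^b)
    multiplies the coefficients by different powers of t, except where the two
    exponents differ by exactly b - I.  So the difference of the two scaled
    forms loses those coefficients, and where both scaled forms are trivial so
    is their difference. *)
Lemma kills_twist A m j b hs : (j < size hs)%N ->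
  pulled (@mul_npoly F (n - p ^ I) n 1) (@mul_npoly F (n - p ^ I) n 'X^(p ^ I))
    j (kills A m) hs ->
  kills (twist j b A) (m - p ^ b) hs.
Proof.
move=> jh [k1 [x hx k2]] y ym.
pose c1 : laurent F := lpoly 'X^(p ^ I); pose c2 : laurent F := lpoly 'X^(p ^ b).
have -> : form p I (twist j b A) (lpoly y :: map (@iota_npoly F n) hs) =
    form p I A (lpoly y :: map (@iota_npoly F n) (upd j (fun=> mul_npoly n 'X^(p ^ I) x) hs))
    - form p I A (lpoly ('X^(p ^ b) * y) :: map (@iota_npoly F n) hs).
  rewrite (map_upd (c := c1) _ hx); last first.
    by rewrite /iota_npoly mul_Xn_npoly inclusion_npoly rmorphM.
  set hs' := map _ hs; have jh' : (j < size hs')%N by rewrite size_map.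
  have := @form_upd_scale _ p I A c1 j.+1 (lpoly y :: hs') jh'; rewrite /= => ->.
  have := @form_upd_scale _ p I A c2 0 (lpoly y :: hs') isT.
  rewrite rmorphM /= => ->.
  rewrite -sumrB; apply: eq_bigr => i _; rewrite -mulrBr; congr (_ * _).
  rewrite -[X in _ + X]mulN1r -formZ -formD; apply: eq_form => l _.
  rewrite /twist /twist_weight /= mulN1r -mulNr -mulrDl rmorphB /=; congr ((_ - _) * _).
    by rewrite /c1 -rmorphXn -exprM.
  by rewrite /c2 -rmorphXn -exprM.
apply: eB; first by apply: k2; apply: leq_trans ym _; exact: leq_subr.
apply: k1; have [->|y0] := eqVneq y 0; first by rewrite mulr0 size_poly0.
rewrite size_mul ?y0 // ?size_polyXn; last by rewrite monic_neq0 ?monicXn.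
by move: y0 ym; rewrite -size_poly_gt0; set a := size y; set d := (p ^ b)%N; clear; lia.
Qed.

Lemma kills_fibre_closed A m k j : (j < k)%N -> fibre_closed k j (kills A m).
Proof.
move=> jk l x y lk kx ky z zm; rewrite upd_const raddfB /=.
set hs := map _ _; have jh : (j < size hs)%N by rewrite size_map lk.
have := form_updB charL I A (iota_npoly x) (iota_npoly y) (j := j.+1)
  (hs := lpoly z :: hs) jh.
rewrite /= => ->.
by apply: eB; [have := kx z zm|have := ky z zm]; rewrite upd_const.
Qed.

End Twisting.

(** * Isolating one coefficient of a form *)

Section Isolation.
Variables (F : finFieldType) (p : nat).
Hypothesis charF : p \in [pchar F].
Variables (C : numClosedFieldType) (e : laurent F -> C).
Hypothesis e_char : residue_character e.
Variables (I n : nat).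
Local Notation q := #|F|.

Let charL : p \in [pchar (laurent F)] := pcharLaurent charF.
Let q1 : (1 < q)%N. Proof. exact: finNzRing_gt1. Qed.
Let q0 : 0 < q%:R :> C. Proof. by rewrite ltr0n ltnW. Qed.

(** Asking that the scaled variable stays below the degree bound costs the
    factor q^(p^I), on top of the squaring of the density. *)
Lemma avg_twist k r m A j b : (j < k)%N ->
  (q%:R ^+ r)^-1 <= avg k (fun hs : seq {poly_n F} =>
    (`[< kills p e I A m hs >])%:R) :> C ->
  (q%:R ^+ (2 * r + p ^ I))^-1 <= avg k (fun hs : seq {poly_n F} =>
    (`[< kills p e I (twist p I j b A) (m - p ^ b) hs >])%:R) :> C.
Proof.
move=> jk rA; pose P := (p ^ I)%N.
have T1_inj : injective (@mul_npoly F (n - P) n 1).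
  move=> x y xy; apply/val_inj.
  by rewrite -(inclusion_npoly x) -(inclusion_npoly y) xy.
have closed := kills_fibre_closed charF e_char (I := I) (n := n) (A := A) (m := m) jk.
have := avg_pulled C (@mul_npoly F (n - P) n 'X^P) T1_inj jk closed.
set d := avg k _ in rA *; move=> le1.
apply: le_trans (le_trans _ le1) _; last first.
  apply: le_avg => hs hsk; apply: le_indic.
  by apply: kills_twist => //; rewrite hsk.
rewrite exprD invfM mulrC mulnC exprM -(exprVn (q%:R ^+ r)); apply: ler_pM.
- by rewrite invr_ge0 exprn_ge0 // ltW.
- by rewrite exprn_ge0 // invr_ge0 exprn_ge0 // ltW.
- rewrite !qpoly.card_npoly !natrX ler_pdivlMr ?exprn_gt0 // mulrC ler_pdivrMr ?exprn_gt0 //.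
  by rewrite -exprD ler_eXn2l ?ltr1n //; lia.
- rewrite lerXn2r ?nnegrE // ?invr_ge0 ?exprn_ge0 // ?(ltW q0) //.
  by apply: le_trans rA; rewrite invr_ge0 exprn_ge0 // ltW.
Qed.

Definition twists (ops : seq (nat * nat)) A :=
  foldr (fun o A => twist p I o.1 o.2 A) A ops : seq nat -> laurent F.

Lemma avg_twists k r m B A ops :
  all (fun o : nat * nat => (o.1 < k) && (o.2 <= B))%N ops ->
  (q%:R ^+ r)^-1 <= avg k (fun hs : seq {poly_n F} =>
    (`[< kills p e I A m hs >])%:R) :> C ->
  (q%:R ^+ (2 ^ size ops * (r + p ^ I) - p ^ I))^-1 <=
    avg k (fun hs : seq {poly_n F} =>
    (`[< kills p e I (twists ops A) (m - size ops * p ^ B) hs >])%:R) :> C.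
Proof.
move=> + rA; elim: ops => [|[j b] ops IH] /=.
  by rewrite mul1n addnK mul0n subn0.
move=> /andP[/andP[jk bB] /IH opsA].
have pI : (0 < p ^ I)%N by rewrite expn_gt0 prime_gt0 // (pcharf_prime charF).
have := avg_twist b jk opsA.
have -> : (2 * (2 ^ size ops * (r + p ^ I) - p ^ I) + p ^ I =
   2 ^ (size ops).+1 * (r + p ^ I) - p ^ I)%N.
  have H : (p ^ I <= 2 ^ size ops * (r + p ^ I))%N.
    by apply: leq_trans (leq_pmull _ _); rewrite ?leq_addl // expn_gt0.
  rewrite expnS -mulnA; move: H; set a := (2 ^ _ * _)%N; set P := (p ^ I)%N.
  by clear; lia.
move=> /le_trans; apply; apply: le_avg => hs _; apply: le_indic => K y ym.
apply: K; apply: leq_trans ym _.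
have : (p ^ b <= p ^ B)%N by rewrite leq_pexp2l // prime_gt0 // (pcharf_prime charF).
by rewrite mulSn; set a := (p ^ b)%N; set b' := (p ^ B)%N; clear; lia.
Qed.

Lemma twistsE ops A l : twists ops A l =
  lpoly (\prod_(o <- ops) twist_weight F p I o.1 o.2 l) * A l.
Proof.
elim: ops => [|o ops IH]; first by rewrite big_nil rmorph1 mul1r.
by rewrite big_cons rmorphM -mulrA -IH.
Qed.

(** For b up to 2 I the number b - I runs over all possible differences of two
    exponents at most I; the difference found in [l0] is spared. *)
Definition isolating (l0 : seq nat) : seq (nat * nat) :=
  [seq (j, b) | j <- iota 0 (size l0).-1,
     b <- [seq b <- iota 0 (2 * I).+1 | b != (I + nth 0 l0 j.+1)%N]].

Lemma mem_isolating l0 j b : ((j, b) \in isolating l0) =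
  [&& j < (size l0).-1, b <= 2 * I & b != I + nth 0 l0 j.+1]%N.
Proof.
apply/allpairsPdep/idP => [[j' [b' [+ + [-> ->]]]]|/and3P[jl bI bl]].
  by rewrite mem_filter !mem_iota /= !add0n ltnS => -> /andP[-> ->].
by exists j, b; rewrite mem_filter !mem_iota bl.
Qed.

Definition isolating_weight l0 : {poly F} :=
  \prod_(o <- isolating l0) twist_weight F p I o.1 o.2 l0.

Let p_gt1 : (1 < p)%N. Proof. exact: prime_gt1 (pcharf_prime charF). Qed.

Lemma twist_weight_eq0 j b l : (twist_weight F p I j b l == 0) =
  (I + nth 0 l j.+1 == b + nth 0 l 0)%N.
Proof.
rewrite /twist_weight -!expnD subr_eq0; apply/eqP/eqP => [|->//].
move=> /(congr1 (fun f : {poly F} => size f)); rewrite !size_polyXn => -[].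
by move/expnI; apply.
Qed.

Lemma isolating_weight_neq0 l0 : nth 0%N l0 0 = 0%N -> isolating_weight l0 != 0.
Proof.
move=> l00; rewrite /isolating_weight big_seq prodf_seq_neq0; apply/allP => -[j b] _ /=.
apply/implyP; rewrite mem_isolating => /and3P[_ _ bl].
by rewrite twist_weight_eq0 l00 addn0 eq_sym.
Qed.

Lemma size_isolating_weight l0 : all (fun i => i <= I)%N l0 -> nth 0%N l0 0 = 0%N ->
  (size (isolating_weight l0) <= (size (isolating l0) * p ^ (2 * I)).+1)%N.
Proof.
move=> l0I l00; rewrite /isolating_weight.
have : all (fun o : nat * nat => o.2 <= 2 * I)%N (isolating l0).
  by apply/allP => -[j b]; rewrite mem_isolating => /and3P[].
elim: (isolating l0) => [|[j b] ops IH] /=; first by rewrite big_nil size_poly1.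
move=> /andP[bI /IH sops]; rewrite big_cons.
apply: leq_trans (size_polyMleq _ _) _.
have sw : (size (twist_weight F p I j b l0) <= (p ^ (2 * I)).+1)%N.
  rewrite /twist_weight -!expnD l00 addn0.
  apply: leq_trans (size_polyD _ _) _; rewrite size_polyN !size_polyXn geq_max !ltnS.
  rewrite !leq_pexp2l ?(ltnW p_gt1) // mul2n -addnn leq_add2l.
  have [jl|jl] := ltnP j.+1 (size l0); last by rewrite nth_default.
  by apply: (allP l0I); rewrite mem_nth.
move: sw sops; rewrite mulSn /=; set a := size _; set b' := size _.
by set d := (p ^ _)%N; set d' := (_ * d)%N; clear; lia.
Qed.

(** A tuple surviving all the twists has the differences of [l0], so it is
    [l0] up to a common shift; containing the exponent 0 rules out the shift. *)
Lemma twists_isolate (A : seq nat -> laurent F) l0 l : (forall l, A l != 0 -> 0%N \in l) ->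
  (0 < size l0)%N -> nth 0%N l0 0 = 0%N -> all (fun i => i <= I)%N l ->
  size l = size l0 -> l != l0 -> twists (isolating l0) A l = 0.
Proof.
move=> A0 sl0 l00 lI ll0 ne; rewrite twistsE.
have [->|Al] := eqVneq (A l) 0; first by rewrite mulr0.
suff /eqP -> : \prod_(o <- isolating l0) twist_weight F p I o.1 o.2 l == 0.
  by rewrite rmorph0 mul0r.
have lI' i : (nth 0 l i <= I)%N.
  have [il|il] := ltnP i (size l); last by rewrite nth_default.
  by apply: (allP lI); rewrite mem_nth.
apply: contraNT ne; rewrite big_seq prodf_seq_neq0 => /allP H.
have diffE j : (j < (size l0).-1)%N -> nth 0%N l j.+1 = (nth 0 l 0 + nth 0 l0 j.+1)%N.
  move=> jl; have [l0j|lj0] := leqP (nth 0%N l 0) (I + nth 0%N l j.+1); last first.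
    by have := lI' 0%N; lia.
  pose b := (I + nth 0 l j.+1 - nth 0 l 0)%N.
  have [bE|bl] := eqVneq b (I + nth 0 l0 j.+1)%N; [|].
    move: bE l0j; rewrite /b.
    move: (nth 0%N l j.+1) (nth 0%N l 0) (nth 0%N l0 j.+1); clear; lia.
  have jb : (j, b) \in isolating l0.
    by rewrite mem_isolating jl bl andbT /b; have := lI' j.+1; lia.
  have := H _ jb; rewrite jb /= twist_weight_eq0 /b subnK //.
  by rewrite eqxx.
have l0E : nth 0%N l 0 = 0%N.
  have /(nthP 0%N)[[|j] jl lj] := A0 _ Al; first exact: lj.
  have := diffE j; rewrite lj -ll0 ltn_predRL => /(_ jl)/esym/eqP.
  by rewrite addn_eq0 => /andP[/eqP].
apply/eqP/(@eq_from_nth _ 0%N) => // -[|j] jl; first by rewrite l0E l00.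
by rewrite diffE ?l0E // -ll0 ltn_predRL.
Qed.

Lemma form_pow_prod (hs : seq {poly_n F}) (l : seq nat) :
  \prod_(x <- zip (map (@iota_npoly F n) hs) l) x.1 ^+ (p ^ x.2) =
  lpoly (pow_prod p l (map val hs)).
Proof.
rewrite /pow_prod; elim: hs l => [|h hs IH] [|i l] /=; rewrite ?big_nil ?rmorph1 //.
by rewrite !big_cons /= IH rmorphM /= rmorphXn.
Qed.

(** After all the twists a single coefficient of the form is left, and the
    triviality of a form with one term in its first variable, which occurs to
    the first power, is a Diophantine condition on the remaining ones. *)
Lemma isolate r (A : seq nat -> laurent F) l0 : (forall l, A l != 0 -> 0%N \in l) ->
  all (fun i => i <= I)%N l0 ->
  (q%:R ^+ r)^-1 <= avg (size l0) (fun hs : seq {poly_n F} =>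
    (`[< kills p e I A n hs >])%:R) :> C ->
  let N := size (isolating (0%N :: l0)) in
  (q%:R ^+ (2 ^ N * (r + p ^ I)))^-1 <= avg (size l0) (fun hs : seq {poly_n F} =>
    (`[< small (n - N * p ^ (2 * I)) (lpoly (pow_prod p l0 (map val hs)) *
       (lpoly (isolating_weight (0%N :: l0)) * A (0%N :: l0))) >])%:R) :> C.
Proof.
move=> A0 l0I rA; set ops := isolating _; set N := size ops => /=.
have opsB : all (fun o : nat * nat => (o.1 < size l0) && (o.2 <= 2 * I))%N ops.
  by apply/allP => -[j b]; rewrite mem_isolating /= => /and3P[-> ->].
have := avg_twists opsB rA; rewrite -/N => H.
apply: le_trans (_ : (q%:R ^+ (2 ^ N * (r + p ^ I) - p ^ I))^-1 <= _).
  by rewrite lef_pV2 ?posrE ?exprn_gt0 // ler_eXn2l ?ltr1n // leq_subr.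
apply: le_trans H _; apply: le_avg => hs hsl; apply: le_indic => K.
apply: (small_of_character e_char) => y /K.
rewrite (@form_single _ p I _ (0%N :: l0)) /= ?size_map ?hsl //; last first.
  by move=> l ll lI ne; apply: twists_isolate => //=; rewrite ll.
rewrite big_cons /= form_pow_prod expn0 expr1 twistsE -/(isolating_weight (0%N :: l0)).
by rewrite mulrCA mulrA; congr (e _ = 1); ring.
Qed.

End Isolation.

(** * Exponents of maximal digit sum *)

Section Digits.
Variable p : nat.
Hypothesis p_gt1 : (1 < p)%N.

Fixpoint digits_rec fuel r : seq nat :=
  if fuel is f.+1 then nseq (r %% p)%N 0%N ++ map S (digits_rec f (r %/ p)%N)
  else [::].

(** The exponents of the powers of [p] whose sum is the base-p expansion
    of [r], with multiplicity; its size is the sum of the digits. *)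
Definition digits r := digits_rec r r.

Lemma digits_recP f r : (r <= f)%N ->
  [/\ (\sum_(i <- digits_rec f r) p ^ i)%N = r,
      forall i, (count_mem i (digits_rec f r) < p)%N,
      all (fun i => i <= f)%N (digits_rec f r) &
      ~~ (p %| r)%N -> exists s, digits_rec f r = 0%N :: s].
Proof.
have p0 : (0 < p)%N by exact: ltnW.
elim: f r => [|f IH] r rf /=.
  move: rf; rewrite leqn0 => /eqP ->; split=> //; first by rewrite big_nil.
  by rewrite dvdn0.
have rpf : (r %/ p <= f)%N.
  case: r rf => [|r] rf; first by rewrite div0n.
  by rewrite -ltnS; apply: leq_trans (ltn_Pdiv _ _) rf.
have [E1 E2 E3 _] := IH _ rpf; split.
- rewrite big_cat big_map big_nseq /= expn0 iter_addn_0 mul1n.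
  under eq_bigr do rewrite expnS.
  by rewrite -big_distrr /= E1 mulnC addnC -divn_eq.
- move=> [|i]; rewrite count_cat count_nseq count_map /=.
    rewrite mul1n (eq_count (a2 := pred0)) // count_pred0 addn0; exact: ltn_pmod.
  rewrite mul0n add0n; exact: E2.
- rewrite all_cat all_map; apply/andP; split; first by apply/allP => i /nseqP[->].
  exact: E3.
- rewrite /dvdn; case: (r %% p)%N => // z _.
  by exists (nseq z 0%N ++ map S (digits_rec f (r %/ p)%N)).
Qed.

Lemma sum_digits r : (\sum_(i <- digits r) p ^ i)%N = r.
Proof. by have [] := digits_recP (leqnn r). Qed.

Lemma count_digits r i : (count_mem i (digits r) < p)%N.
Proof. by have [] := digits_recP (leqnn r). Qed.

Lemma digits_le r : all (fun i => i <= r)%N (digits r).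
Proof. by have [] := digits_recP (leqnn r). Qed.

Lemma digits_cons0 r : ~~ (p %| r)%N -> exists s, digits r = 0%N :: s.
Proof. by have [] := digits_recP (leqnn r). Qed.

Lemma digits_perm_inj r r' : perm_eq (digits r) (digits r') -> r = r'.
Proof. by move=> P; rewrite -(sum_digits r) -(sum_digits r') (perm_big _ P). Qed.

End Digits.

Lemma polar_coef_nat (L : fieldType) l s : exists m : nat, polar_coef L l s = m%:R.
Proof.
elim: l s => [|i l IH] s /=; first by exists (s == [::]).
by have [m ->] := IH (rem i s); exists (count_mem i s * m)%N; rewrite natrM.
Qed.

(** Approximation of [a] by a fraction, of the quality claimed for the
    coefficient of f^r, with constants proportional to [k + 1] when the mean
    has size q^(-k). *)
Definition approximable (F : fieldType) c k n r (a : laurent F) :=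
  exists2 g : {poly F}, g != 0 /\ (size g <= c * k.+1)%N &
    small (r * n - c * k.+1) (lpoly g * a).

Lemma approximableW (F : fieldType) c c' k n r (a : laurent F) : (c <= c')%N ->
  approximable c k n r a -> approximable c' k n r a.
Proof.
move=> cc' [g [g0 gc] ga].
have H : (c * k.+1 <= c' * k.+1)%N by rewrite leq_mul2r cc' orbT.
exists g; first by split=> //; exact: leq_trans H.
by apply: smallW ga; exact: leq_sub2l.
Qed.

Lemma uniform_constant (T : eqType) (s : seq T) (P : T -> nat -> Prop) :
  (forall x c c', (c <= c')%N -> P x c -> P x c') ->
  (forall x, x \in s -> exists c, P x c) ->
  exists c, forall x, x \in s -> P x c.
Proof.
move=> PW; elim: s => [|x s IH] H; first by exists 0%N.
have [c Hc] := H x (mem_head _ _).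
have [|c' Hc'] := IH; first by move=> y ys; apply: H; rewrite inE ys orbT.
exists (c + c')%N => y; rewrite inE => /orP[/eqP ->|ys].
  exact: PW (leq_addr _ _) Hc.
exact: PW (leq_addl _ _) (Hc' y ys).
Qed.

Section TopLayer.
Variables (p : nat) (K : seq nat) (d : nat).
Hypothesis p_prime : prime p.
Hypothesis K_uniq : uniq K.
Hypothesis K_coprime : forall r : nat, r \in K -> ~~ (p %| r)%N.
Hypothesis K_layer : forall r : nat, r \in K -> size (digits p r) = d.

Definition top_layer_claim r0 c :=
  forall (F : finFieldType) (C : numClosedFieldType) (e : laurent F -> C),
  p \in [pchar F] -> residue_character e ->
  forall (n k : nat) (alpha : nat -> laurent F) (psi : {poly_n F} -> laurent F),
  (c * k.+1 <= n)%N -> pdeg d psi ->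
  (#|F|%:R ^+ k)^-1 <= `|mean (fun x : {poly_n F} =>
     e (\sum_(r <- K) alpha r * iota_npoly x ^+ r + psi x))| :> C ->
  approximable c k n r0 (alpha r0).

(** The lower-degree part dies under differencing, which leaves the forms of the
    exponents of digit sum [d].  Isolating the tuple of the digits of r0 leaves
    a nonzero multiple of the coefficient alpha r0, and this multiple joins the
    denominator. *)
Lemma top_layer_single (r0 : nat) : r0 \in K -> exists c, top_layer_claim r0 c.
Proof.
move=> r0K; have p_gt1 := prime_gt1 p_prime.
have [l0 l0E] := digits_cons0 p_gt1 (K_coprime r0K).
pose I := (\max_(r <- K) r)%N.
have digI r : r \in K -> all (fun i => i <= I)%N (digits p r).
  move=> rK; apply/allP => i /(allP (digits_le p_gt1 r)) /leq_trans; apply.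
  by rewrite /I (big_rem r) //= leq_maxl.
have dE : d = (size l0).+1 by rewrite -(K_layer r0K) l0E.
have [c2 dioph] := small_of_dense_multi p l0.
pose N := size (isolating I (0%N :: l0)); pose c1 := (N * p ^ (2 * I))%N.
pose D := (2 ^ N * 2 ^ size l0 + 2 ^ N * p ^ I + 1)%N.
exists (c2 * D + c1 + 1)%N => F C e charF e_char n k alpha psi cn psid.
have charL := pcharLaurent charF.
have eD : forall a b, e (a + b) = e a * e b by case: e_char.
have e_norm : forall a, `|e a| = 1 by case: e_char.
move=> Ephi.
pose A l := \sum_(r <- K) alpha r * polar_coef (laurent F) l (digits p r).
pose iota := @iota_npoly F n.
pose phi x := \sum_(r <- K) alpha r * mono p (digits p r) (iota x) + psi x.
have {}Ephi : (#|F|%:R ^+ k)^-1 <= `|mean (fun x => e (phi x))| :> C.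
  apply: le_trans Ephi _; rewrite le_eqVlt; apply/orP; left; apply/eqP.
  congr `|_|; apply: eq_mean => x; congr (e (_ + _)).
  by apply: eq_bigr => r _; rewrite monoE sum_digits.
have mono_d r : r \in K ->
    pdeg (size l0).+2 (fun x : {poly_n F} => mono p (digits p r) (iota x)).
  move=> rK; have -> : (size l0).+2 = (size (digits p r)).+1 by rewrite K_layer // dE.
  exact: (pdeg_mono charL).
have phid : pdeg (size l0).+2 phi.
  apply: pdegD; last by apply: pdegW psid; rewrite dE.
  apply: pdeg_sum => r rK; exact: pdegZ (mono_d r rK).
have diffsE x hs : size hs = size l0 -> diffs (x :: hs) phi 0 =
    form p I A (iota x :: map iota hs).
  move=> hsl; rewrite diffsD (diffs_pdeg0 (f := psi)) ?addr0; last first.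
    by have -> : size (x :: hs) = d by rewrite /= hsl dE.
  rewrite diffs_sum -(map_cons iota) /A form_sum; apply: eq_big_seq => r rK.
  by rewrite diffsZ formZ (@diffs_mono _ p charL _ (@iota_npoly F n) I) ?digI //= hsl -dE K_layer.
have killsA : (#|F|%:R ^+ (k * 2 ^ size l0))^-1 <= avg (size l0)
    (fun hs : seq {poly_n F} => (`[< kills p e I A n hs >])%:R) :> C.
  rewrite exprM -exprVn; apply: le_trans (_ : `|mean (fun x => e (phi x))| ^+ (2 ^ size l0) <= _).
    by rewrite lerXn2r ?nnegrE ?invr_ge0 ?exprn_ge0 ?ler0n.
  apply: le_trans (weyl_differencing eD e_norm phid) _.
  apply: le_avg => hs hsl; apply: le_indic => H y yn.
  by have := H (npolyp n y); rewrite diffsE // /iota /iota_npoly /= npolypK.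
have A0 l : A l != 0 -> 0%N \in l.
  move=> Al; have : exists2 r, r \in K & polar_coef (laurent F) l (digits p r) != 0.
    apply: contrapT => H; move/eqP: Al; apply.
    rewrite /A big_seq big1 // => r rK; apply/eqP; rewrite mulf_eq0 orbC.
    by apply/orP; left; apply/negPn/negP => z; apply: H; exists r.
  move=> [r rK /polar_coef_neq0/perm_mem ->].
  by have [s ->] := digits_cons0 p_gt1 (K_coprime rK); rewrite mem_head.
have Al0 : A (0%N :: l0) = polar_coef _ (digits p r0) (digits p r0) * alpha r0.
  rewrite /A -l0E (bigD1_seq r0) //= mulrC big1 ?addr0 // => r rr0.
  apply/eqP; rewrite mulf_eq0; apply/orP; right; apply: contraNT rr0.
  by move=> /polar_coef_neq0/(digits_perm_inj p_gt1) ->.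
have [m mE] := polar_coef_nat (laurent F) (digits p r0) (digits p r0).
have m0 : (m%:R : {poly F}) != 0.
  rewrite -lpoly_eq0 rmorph_nat -mE; apply: (polar_coef_diag charL) => i.
  exact: count_digits.
have l0I : all (fun i => i <= I)%N l0 by have := digI _ r0K; rewrite l0E => /andP[].
have := isolate charF e_char A0 l0I killsA; rewrite -/N -/c1 /=.
set k' := (2 ^ N * _)%N; set W := isolating_weight _ _ _ _ => avg_small.
have k'D : (k'.+1 <= D * k.+1)%N.
  rewrite /k' /D; move: (2 ^ N)%N (2 ^ size l0)%N (p ^ I)%N; clear; nia.
have c2k' : (c2 * k'.+1 <= c2 * D * k.+1)%N by rewrite -mulnA leq_mul2l k'D orbT.
have c1k : (c1 <= c1 * k.+1)%N by rewrite leq_pmulr.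
rewrite mulnDl mulnDl mul1n in cn.
have [h1 h2] : (c2 * k'.+1 <= n)%N /\ (c2 * k'.+1 <= n - c1)%N.
  by move: cn c2k' c1k; set a := (c2 * _)%N; set b := (c2 * _ * _)%N; clear; lia.
have [g [g0 gs] gW] := dioph F C charF n k' (n - c1)%N _ h1 h2 avg_small.
have W0 : W != 0 by apply: isolating_weight_neq0.
exists (g * (W * m%:R)).
  split; first by rewrite !mulf_neq0.
  have sW : (size W <= c1.+1)%N.
    by apply: size_isolating_weight => //=; rewrite l0I.
  have sWm : (size (W * m%:R)%R <= c1.+1)%N.
    by rewrite mulr_natr; apply: leq_trans sW; rewrite -scaler_nat size_scale_leq.
  apply: leq_trans (size_polyMleq _ _) _; rewrite mulnDl mulnDl mul1n.
  move: gs sWm c2k' c1k; set a := size g; set b := size _; clear; lia.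
rewrite !rmorphM /= rmorph_nat -mE -!mulrA -Al0 mulrA -/W.
apply: smallW; last by rewrite -mulrA; exact: gW.
have -> : (r0 * n = n + n * (\sum_(i <- l0) p ^ i))%N.
  by rewrite -{1}(sum_digits p_gt1 r0) l0E big_cons expn0 mulnDl mul1n mulnC.
rewrite mulnDl mulnDl mul1n; move: cn c2k' c1k.
set E := (n * _)%N; clear; lia.
Qed.

Lemma top_layer : exists c, forall r : nat, r \in K -> top_layer_claim r c.
Proof.
apply: uniform_constant => [r c c' cc' H|]; last exact: top_layer_single.
move=> F C e charF e_char n k alpha psi cn psid E.
apply: (approximableW cc'); apply: (H F C e charF e_char n k alpha psi _ psid E).
by apply: leq_trans cn; rewrite leq_mul2r cc' orbT.
Qed.

End TopLayer.

(** * Descent through the digit sums *)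

Section Layers.
Variables (p : nat) (K : seq nat).
Hypothesis p_prime : prime p.
Hypothesis K_uniq : uniq K.
Hypothesis K_coprime : forall r : nat, r \in K -> ~~ (p %| r)%N.

Lemma common_denominator (F : fieldType) c k n (s : seq nat) (alpha : nat -> laurent F) :
  (forall r : nat, r \in s -> approximable c k n r (alpha r)) ->
  exists2 g : {poly F}, g != 0 /\ (size g <= (size s * (c * k.+1)).+1)%N &
    forall r : nat, r \in s -> small (r * n - size s * (c * k.+1)) (lpoly g * alpha r).
Proof.
rewrite /approximable; set M := (c * k.+1)%N.
elim: s => [|r s IH] H; first by exists 1; rewrite ?oner_neq0 ?size_poly1.
have [g [g0 gs] gsmall] := IH (fun r0 (rs : r0 \in s) => H r0 (@mem_behead _ (r :: s) r0 rs)).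
have [h [h0 hs] hr] := H r (mem_head _ _).
exists (h * g).
  split; first by rewrite mulf_neq0.
  apply: leq_trans (size_polyMleq _ _) _; rewrite /= mulSn.
  by move: gs hs; set a := size g; set b := size h; clear; lia.
move=> r'; rewrite inE /= mulSn subnDA => /orP[/eqP ->|r's].
  by rewrite [h * g]mulrC rmorphM /= -mulrA; exact: small_lpolyM.
rewrite rmorphM /= -mulrA subnAC; apply: small_lpolyM; first exact: gsmall.
exact: leq_trans hs _.
Qed.

(** The sum runs over all of [K] whatever [d] is, so that the claims for
    successive [d] speak of the same sum. *)
Definition layer_claim d c :=
  forall (F : finFieldType) (C : numClosedFieldType) (e : laurent F -> C),
  p \in [pchar F] -> residue_character e ->
  forall (n k : nat) (alpha : nat -> laurent F), (c * k.+1 <= n)%N ->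
  (#|F|%:R ^+ k)^-1 <= `|mean (fun x : {poly_n F} =>
     e (\sum_(r <- K) alpha r * iota_npoly x ^+ r))| :> C ->
  forall r : nat, r \in K -> (d <= size (digits p r))%N ->
  approximable c k n r (alpha r).

(** The mean is the average of the means over the translates of a
    progression, so one of them is at least as large. *)
Lemma mean_on_progression (F : finFieldType) (C : numFieldType) n n' (g : {poly F})
    (f : {poly_n F} -> C) (c : C) : c \is Num.real ->
  c <= `|mean f| ->
  exists x, c <= `|mean (fun z : {poly_n' F} => f (x + mul_npoly n g z))|.
Proof.
move=> cr cf.
have N0 m : (0 < #|{poly_m F}|)%N by apply/card_gt0P; exists 0.
apply: (exists_ge_mean (N0 n) cr) => //; apply: le_trans cf _.
have -> : mean f = mean (fun x => mean (fun z : {poly_n' F} => f (x + mul_npoly n g z))).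
  have E : mean (fun z : {poly_n' F} => mean (fun x => f (x + mul_npoly n g z))) = mean f.
    transitivity (mean (fun _ : {poly_n' F} => mean f)); last exact: mean_cst.
    apply: eq_mean => z.
    by rewrite /mean [in RHS](reindex_inj (addIr (mul_npoly n g z))).
  rewrite -{1}E /mean -!mulr_suml exchange_big /= -!mulrA; congr (_ * _).
  by rewrite mulrC.
rewrite {1 3}/mean normrM normfV normr_nat ler_wpM2r ?invr_ge0 ?ler0n //.
exact: ler_norm_sum.
Qed.

(** On a progression whose modulus is a common denominator for the higher
    layers, these contribute a constant phase, while the terms of layer [d]
    keep their leading coefficients up to powers of the modulus. *)
Lemma layer_step d c : layer_claim d.+1 c -> exists c', layer_claim d c'.
Proof.
move=> claim; have p_gt1 := prime_gt1 p_prime.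
pose sz r := size (digits p r).
pose Kd := [seq r <- K | sz r == d]; pose Ks := [seq r <- K | d < sz r]%N.
have [ct top] : exists ct, forall r : nat, r \in Kd -> top_layer_claim p Kd d r ct.
  apply: top_layer => //; first exact: filter_uniq.
    by move=> r; rewrite mem_filter => /andP[_]; exact: K_coprime.
  by move=> r; rewrite mem_filter => /andP[/eqP].
pose R := (\max_(r <- K) r)%N.
pose c' := (ct + R.+1 * (size Ks * c) + c + 1)%N.
exists c' => F C e charF e_char n k alpha cn Emean r rK rd.
have cc' : (c * k.+1 <= c' * k.+1)%N.
  by rewrite leq_mul2r /c'; apply/orP; right; lia.
have high r' : r' \in Ks -> approximable c k n r' (alpha r').
  rewrite mem_filter => /andP[dr' r'K].
  by apply: (claim F C e charF e_char _ _ _ _ Emean) => //; exact: leq_trans cc' cn.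
have [rd'|rd'] := ltnP d (sz r).
  apply: approximableW (high r _); last by rewrite mem_filter rd' rK.
  by rewrite /c'; lia.
have rKd : r \in Kd by rewrite mem_filter rK eqn_leq rd' rd.
have [g [g0 gs] gsmall] := common_denominator high.
pose M := (size Ks * (c * k.+1))%N; rewrite -/M in gs gsmall.
have rR : (r <= R)%N by rewrite /R (big_rem r) //= leq_maxl.
have boundM : (ct * k.+1 + R.+1 * M + k.+1 <= c' * k.+1)%N.
  rewrite /c' /M [(size Ks * (c * k.+1))%N]mulnA mulnA -mulnDl -{2}[k.+1]mul1n -mulnDl.
  by rewrite leq_mul2r; apply/orP; right; rewrite /=; lia.
have Mn : (M <= n)%N.
  apply: leq_trans cn; apply: leq_trans boundM; rewrite mulSn.
  by move: (ct * _)%N (R * _)%N; clear; lia.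
pose n' := (n - M)%N.
have val_gz (z : {poly_n' F}) : val (mul_npoly n g z) = g * val z.
  by apply: val_mul_npoly => //; move: gs Mn; rewrite /n'; set a := size g; clear; lia.
have nreal : (#|F|%:R ^+ k)^-1 \is @Num.real C.
  by rewrite realV rpredX // realn.
have [x0 Ex0] := mean_on_progression n' g nreal Emean.
have [eD e_norm e_res _] := e_char.
pose iotag : {additive {poly_n' F} -> laurent F} := @iota_npoly F n \o @mul_npoly F n' n g.
have iotagE z : iotag z = lpoly g * iota_npoly z.
  by rewrite /iotag /= {1}/iota_npoly val_gz rmorphM.
pose f0 := iota_npoly x0.
pose psi (z : {poly_n' F}) : laurent F :=
  \sum_(r <- Kd) alpha r * ((f0 + iotag z) ^+ r - iotag z ^+ r) +
  \sum_(r <- K | (sz r < d)%N) alpha r * (f0 + iotag z) ^+ r.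
have charL := pcharLaurent charF.
have psid : pdeg d psi.
  apply: pdegD.
    apply: pdeg_sum => r'; rewrite mem_filter => /andP[/eqP <- _].
    apply: pdegZ; apply: pdeg_eq (pdeg_mono_shift charL iotag (digits p r') f0) => z.
    by rewrite !monoE sum_digits.
  apply: (@pdeg_eq _ _ _ (fun z => \sum_(r <- [seq r <- K | (sz r < d)%N]) alpha r * (f0 + iotag z) ^+ r)).
    by move=> z; rewrite big_filter.
  apply: pdeg_sum => r'; rewrite mem_filter => /andP[r'd _].
  apply: pdegZ; apply: pdegW r'd _.
  apply: pdeg_eq (pdeg_mono_translate charL iotag (digits p r') f0) => z.
  by rewrite !monoE sum_digits.
(* the difference of the powers is g times a polynomial too small to bring a
   nonzero coefficient of g * alpha up to t^(-1) *)
have frozen r' z : r' \in Ks -> e (alpha r' * ((f0 + iotag z) ^+ r' - f0 ^+ r')) = 1.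
  move=> r'K; apply: e_res.
  pose w := val x0 + g * val z.
  pose v := \sum_(i < r') w ^+ (r'.-1 - i) * val x0 ^+ i.
  have -> : alpha r' * ((f0 + iotag z) ^+ r' - f0 ^+ r') =
      lpoly (val z * v) * (lpoly g * alpha r').
    have -> : (f0 + iotag z) ^+ r' - f0 ^+ r' = lpoly (g * (val z * v)).
      rewrite mulrA /iotag /= {1}/iota_npoly val_gz /f0 /iota_npoly -rmorphD.
      rewrite -!rmorphXn -rmorphB subrXX /= [_ + _ - _]addrAC subrr add0r.
      by congr (lpoly (_ * _)).
    by rewrite rmorphM /=; ring.
  apply: (res_small (gsmall r' r'K)); rewrite -/M.
  have r'0 : (0 < r')%N.
    have := K_coprime (r := r'); move: r'K; rewrite mem_filter => /andP[_ ->].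
    by case: (r') => // /(_ isT); rewrite dvdn0.
  have sw : (size w <= n)%N by rewrite /w -val_gz -raddfD; exact: size_npoly.
  have s0 : (size (val x0) <= n)%N by exact: size_npoly.
  have spow (u : {poly F}) j : (size u <= n -> size (u ^+ j) <= (n * j).+1)%N.
    move=> un; apply: leq_trans (size_poly_exp_leq _ _) _.
    by rewrite ltnS leq_mul2r (leq_trans (leq_pred _) un) orbT.
  have sv : (size v <= (n * r'.-1).+1)%N.
    apply: leq_trans (size_sum _ _ _) _; apply/bigmax_leqP => i _.
    apply: leq_trans (size_polyMleq _ _) _.
    have -> : (n * r'.-1 = n * (r'.-1 - i) + n * i)%N.
      by rewrite -mulnDr subnK // -ltnS prednK.
    move: (spow w (r'.-1 - i)%N sw) (spow (val x0) i s0).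
    move: (n * _)%N (n * _)%N; set a := size _; set b := size _; clear; lia.
  apply: leq_trans (size_polyMleq _ _) _; have := size_npoly z.
  have -> : (r' * n = n + n * r'.-1)%N by rewrite -mulnS prednK // mulnC.
  move: sv Mn; rewrite /n'; set a := size v; set b := size _; set E := (n * _)%N.
  by clear; lia.
have main z : e (\sum_(r <- K) alpha r * iota_npoly (x0 + mul_npoly n g z) ^+ r) =
    e (\sum_(r <- Ks) alpha r * f0 ^+ r) *
    e (\sum_(r <- Kd) (lpoly (g ^+ r) * alpha r) * iota_npoly z ^+ r + psi z).
  have -> : iota_npoly (x0 + mul_npoly n g z) = f0 + iotag z by rewrite raddfD.
  have split3 : \sum_(r <- K) alpha r * (f0 + iotag z) ^+ r =
      \sum_(r <- Ks) alpha r * f0 ^+ r +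
      (\sum_(r <- Kd) (lpoly (g ^+ r) * alpha r) * iota_npoly z ^+ r + psi z) +
      \sum_(r <- Ks) alpha r * ((f0 + iotag z) ^+ r - f0 ^+ r).
    rewrite (bigID (fun r => d < sz r)%N) /= -big_filter -/Ks addrAC.
    rewrite -big_split /=; congr (_ + _).
      by apply: eq_bigr => r' _; rewrite mulrBr addrC subrK.
    rewrite (bigID (fun r => sz r == d)) /= /psi addrA; congr (_ + _).
      rewrite -big_split /= -big_filter /Kd.
      have -> : [seq r <- K | ~~ (d < sz r)%N & sz r == d] = [seq r <- K | sz r == d].
        by apply: eq_filter => r' /=; case: ltngtP.
      apply: eq_bigr => r' _; move: ((f0 + iotag z) ^+ r') => A.
      rewrite -[iota_npoly (mul_npoly n g z)]/(iotag z) iotagE exprMn rmorphXn.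
      move: (lpoly g ^+ r') (iota_npoly z ^+ r') => B1 B2.
      by ring.
    by apply: eq_bigl => r'; case: ltngtP.
  rewrite split3 eD eD.
  suff -> : e (\sum_(r <- Ks) alpha r * ((f0 + iotag z) ^+ r - f0 ^+ r)) = 1.
    by rewrite mulr1.
  rewrite big_seq; apply: (big_ind (fun a => e a = 1)) => [|a b ea eb|r' r'K].
  - exact: (character0 eD e_norm).
  - by rewrite eD ea eb mulr1.
  - exact: frozen.
have H := top r rKd F C e charF e_char n' k (fun r => lpoly (g ^+ r) * alpha r) psi _ psid _.
have {H}[| |h [h0 hs] hsmall] := H.
- rewrite /n'; move: cn boundM; rewrite mulSn.
  by move: (ct * _)%N (R * _)%N; clear; lia.
- apply: le_trans Ex0 _; rewrite (eq_mean main) meanZ normrM e_norm mul1r.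
  exact: lexx.
have sgr : (size (g ^+ r) <= (r * M).+1)%N.
  apply: leq_trans (size_poly_exp_leq _ _) _; rewrite ltnS mulnC leq_mul2l.
  by apply/orP; right; move: gs; set a := size g; clear; lia.
have rM : (r * M <= R * M)%N by rewrite leq_mul2r rR orbT.
exists (h * g ^+ r).
  split; first by rewrite mulf_neq0 // expf_neq0.
  apply: leq_trans (size_polyMleq _ _) _; move: hs sgr boundM rM; rewrite mulSn.
  set a := size h; set b := size _; move: (ct * _)%N (R * _)%N (r * _)%N; clear; lia.
rewrite rmorphM /= -mulrA; apply: smallW hsmall; rewrite /n' mulnBr.
move: boundM rM; rewrite mulSn.
by move: (ct * _)%N (R * _)%N (r * M)%N (r * n)%N; clear; lia.
Qed.

Lemma layers_descend d : (exists c, layer_claim d c) -> exists c, layer_claim 0 c.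
Proof. by elim: d => // d IH [c /layer_step]. Qed.

(** The descent starts above the largest digit sum, where there is nothing to
    approximate. *)
Lemma all_layers : exists c, layer_claim 0 c.
Proof.
apply: (@layers_descend (\max_(r <- K) size (digits p r)).+1); exists 0%N.
move=> F C e _ _ n k alpha _ _ r rK.
by rewrite (big_rem r) //= ltnNge leq_maxl.
Qed.

End Layers.

(** * The additive character *)

Section AddcharProperties.
Variables (R : realType) (F : finFieldType) (p : nat).
Hypothesis charF : p \in [pchar F].
Local Notation L := (pPrimeCharType charF).

Lemma cisD (x y : R) : cis (x + y) = cis x * cis y.
Proof.
rewrite /cis cosD sinD; apply/eqP; rewrite eq_complex /=.
by rewrite eqxx addrC (mulrC (sin x)) eqxx.
Qed.

Lemma cis0 : cis (0 : R) = 1.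
Proof. by rewrite /cis cos0 sin0. Qed.

Lemma norm_cis (x : R) : `|cis x| = 1.
Proof. by rewrite /cis normc_def /= cos2Dsin2 sqrtr1. Qed.

Lemma cis_2pin (k : nat) : cis (2 * pi * k%:R : R) = 1.
Proof.
elim: k => [|k IH]; first by rewrite mulr0 cis0.
have -> : 2 * pi * k.+1%:R = 2 * pi * k%:R + pi *+ 2 :> R.
  by rewrite -(natr1 k) mulrDr mulr1 mulr_natl.
by rewrite cisD IH mul1r /cis cos2pi sin2pi.
Qed.

Lemma cis_eq1 (x : R) : 0 <= x -> x < 2 * pi -> cis x = 1 -> x = 0.
Proof.
move=> x0 x2 /eqP; rewrite eq_complex /= => /andP[/eqP cx _].
apply/eqP; rewrite eq_le x0 andbT leNgt; apply/negP => xgt0.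
have s0 : 0 < sin (x / 2).
  apply: sin_gt0_pi; rewrite divr_gt0 //= ltr_pdivrMr // mulrC; exact: x2.
have : sin (x / 2) ^+ 2 = 0.
  have E2 : (x / 2) *+ 2 = x by rewrite -(mulr_natr (x / 2)) mulfVK ?pnatr_eq0.
  have := cos_mulr2n (x / 2); rewrite E2 cx.
  rewrite cos2sin2; move: (sin _ ^+ 2) => s Es.
  have /eqP : s *+ 2 = 0.
    by transitivity (1 - ((1 - s) *+ 2 - 1)); [ring|rewrite -Es subrr].
  by rewrite mulrn_eq0 => /eqP.
by move/eqP; rewrite sqrf_eq0 gt_eqF.
Qed.

Let p_gt0 : (0 < p)%N. Proof. exact: prime_gt0 (pcharf_prime charF). Qed.

Definition root_of_unity (x : 'F_p) : R[i] :=
  cis (2 * pi / p%:R * (x : nat)%:R).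

Lemma root_of_unityD x y :
  root_of_unity (x + y) = root_of_unity x * root_of_unity y.
Proof.
rewrite /root_of_unity -cisD -mulrDr -natrD.
have -> : ((x + y)%R : nat) = (((x : nat) + y) %% p)%N.
  by rewrite /=; congr (_ %% _)%N; exact: Fp_cast (pcharf_prime charF).
set k := ((x + y) %/ p)%N; set m := ((x + y) %% p)%N.
have -> : (x + y)%N%:R = k%:R * p%:R + m%:R :> R by rewrite -natrM -natrD -divn_eq.
rewrite (mulrDr (2 * pi / p%:R)) cisD.
have -> : 2 * pi / p%:R * (k%:R * p%:R) = 2 * pi * k%:R :> R.
  by rewrite [k%:R * _]mulrC mulrA mulfVK // pnatr_eq0 -lt0n.
by rewrite cis_2pin mul1r.
Qed.

Lemma Fp_traceD (x y : F) :
  Fp_trace charF (x + y) = Fp_trace charF x + Fp_trace charF y.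
Proof. by rewrite /Fp_trace -linearD -raddfD; reflexivity. Qed.

Lemma Fp_trace0 : Fp_trace charF 0 = 0.
Proof. by apply: (addrI (Fp_trace charF 0)); rewrite -Fp_traceD !addr0. Qed.

(** A vanishing trace would be a linear dependence between the automorphisms
    in the Galois group. *)
Lemma Fp_trace_nondegenerate (x : F) :
  (forall c : F, Fp_trace charF (c * x) = 0) -> x = 0.
Proof.
move=> tr0; apply: contrapT => /eqP x0.
pose Gal := ('Gal({:L} / 1%AS))%g.
have P1 : (1%g : gal_of {:L}) \in Gal by exact: fingroup.group1.
have [a _] := @gal_independent_contra _ _ {:L} (mem Gal) (fun=> 1) 1%g P1 (oner_neq0 _).
move/eqP; apply.
under eq_bigr do rewrite mul1r.
have := tr0 ((a : F) / x); rewrite mulfVK // => ta.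
have := Fp_traceE charF a; rewrite ta scale0r => /esym E; exact: E.
Qed.

Lemma root_of_unity_eq1 x : root_of_unity x = 1 -> x = 0.
Proof.
have P0 : 0 < p%:R :> R by rewrite ltr0n.
have xp : (x < p)%N.
  by have := ltn_ord x; rewrite [X in (_ < X)%N](Fp_cast (pcharf_prime charF)).
have twopi0 : 0 < 2 * pi :> R by rewrite mulr_gt0 ?pi_gt0.
move=> /cis_eq1 H; apply/val_inj/eqP => /=; rewrite -(pnatr_eq0 R).
have h1 : 0 <= 2 * pi / p%:R * (x : nat)%:R :> R.
  by rewrite mulr_ge0 ?ler0n // divr_ge0 ?ler0n // ltW.
have h2 : 2 * pi / p%:R * (x : nat)%:R < 2 * pi :> R.
  by rewrite mulrAC ltr_pdivrMr // ltr_pM2l // ltr_nat.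
have /eqP := H h1 h2.
by rewrite mulf_eq0 (gt_eqF (divr_gt0 twopi0 P0)).
Qed.

Lemma addchar_residue_character :
  @residue_character R[i] F (addchar R charF).
Proof.
split=> [a b|a|a a0|a H]; rewrite /addchar.
- by rewrite /res lcoefD Fp_traceD; exact: root_of_unityD.
- exact: norm_cis.
- by rewrite a0 Fp_trace0 mulr0 cis0.
apply: Fp_trace_nondegenerate => c; apply: root_of_unity_eq1.
rewrite -(H c) /addchar; congr (root_of_unity (Fp_trace _ _)).
rewrite /res lcoef_lpolyM size_polyC; have [->|c0] := eqVneq c 0.
  by rewrite big_ord0 mul0r.
by rewrite big_ord1 coefC subr0.
Qed.

End AddcharProperties.

Section PolynomialPart.
Variable F : fieldType.

(** The polynomial part of b serves as the numerator. *)
Lemma ord_sub_poly (R : realType) m (b : laurent F) : small m b ->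
  exists a : {poly F}, (ord R (b - lpoly a)%R < (- (m%:R : R))%:E)%E.
Proof.
move=> bm; have [J HJ] := lcoef_bounded b.
pose a := \poly_(i < (absz J).+1) lcoef b i%:Z; exists a.
have coefE (i : nat) : lcoef (b - lpoly a) i%:Z = 0.
  rewrite lcoefD lcoefN /= coef_poly; case: ltnP => iJ; first by rewrite subrr.
  by rewrite HJ ?subr0 //; lia.
have [->|ne] := eqVneq (b - lpoly a) 0; first by rewrite ord0E ltNyr.
have [j [j0 jmax]] := leads_exists ne.
rewrite (ord_leads R (conj j0 jmax)) lte_fin.
case: j j0 {jmax} => [i|i]; first by rewrite coefE eqxx.
rewrite lcoefD lcoefN /= subr0 => bi.
have mi : (m <= i)%N by rewrite leqNgt; apply/negP => /bm E; rewrite E eqxx in bi.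
by rewrite NegzE mulrNz ltrN2 -pmulrn ltr_nat ltnS.
Qed.

Lemma approximable_monic c k n r (a : laurent F) : approximable c k n r a ->
  exists g : {poly F}, [/\ g \is monic, ((size g).-1 <= c * k.+1)%N &
    small (r * n - c * k.+1) (lpoly g * a)].
Proof.
move=> [g [g0 gs] ga]; exists ((lead_coef g)^-1 *: g).
have lc0 : lead_coef g != 0 by rewrite lead_coef_eq0.
split; first by rewrite monicE lead_coefZ mulVf.
  by rewrite size_scale ?invr_neq0 //; exact: leq_trans (leq_pred _) gs.
rewrite -mul_polyC rmorphM /= -mulrA -[X in small X]subn0.
by apply: small_lpolyM ga _; rewrite size_polyC; case: (_ != 0).
Qed.

End PolynomialPart.

(** * The corollary *)

Theorem corollaryC1 (R : realType) (p q : nat) (p_prime : prime p)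
    (q_power : exists2 m : nat, (0 < m)%N & q = (p ^ m)%N)
    (K : {fset nat})
    (K_gt0 : forall r : nat, r \in K -> (0 < r)%N)
    (K_coprime : forall r : nat, r \in K -> coprime r p) :
  exists c C D : R, [/\ 0 < c, 0 < C & 0 < D] /\
  exists n0 : nat, forall n : nat, (0 < n)%N -> (n0 <= n)%N ->
  forall (F : finFieldType) (charF : p \in [pchar F]), #|F| = q ->
  forall (alpha : K -> laurent F) (eta : R),
    0 <= eta -> eta <= c * n%:R ->
    q%:R `^ (n%:R - eta) <=
      complex.Re `| \sum_(f : {poly_ n F})
        addchar R charF (\sum_(r : K) alpha r * lpoly f ^+ val r) | ->
  forall r : K, exists a g : {poly F},
    [/\ g \is monic,
        (ord R (lpoly g * alpha r - lpoly a)%R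
           < (- ((val r)%:R * n%:R) + C * eta + D)%R%:E)%E
      & (size g).-1%:R <= C * eta + D].
Proof.
have Kp (r : nat) : r \in (K : seq nat) -> ~~ (p %| r)%N.
  by move=> rK; rewrite -prime_coprime // coprime_sym; exact: K_coprime.
have [c0 layers0] := all_layers p_prime (fset_uniq K) Kp.
pose M : R := (c0.+1)%:R; have M0 : 0 < M by rewrite ltr0n.
exists (2 * M)^-1, M, (2 * M); split; first by split; rewrite ?invr_gt0 ?mulr_gt0.
exists (4 * c0.+1)%N => n n_gt0 n_large F charF Fq alpha eta eta0 eta_le sum_ge r.
(* the integral loss, so that q^(n - k) bounds the sum from below *)
pose k := (Num.truncn eta).+1.
have [eta_k k_eta] : eta <= k%:R /\ k%:R <= eta + 1.
  have /andP[t1 t2] := truncn_itv eta0.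
  by rewrite /k -natr1 lerD2r t1 natr1 ltW.
have loss : (c0 * k.+1)%:R <= M * eta + 2 * M.
  apply: le_trans (_ : M * (eta + 2) <= _); last by rewrite mulrDr [M * 2]mulrC.
  rewrite natrM ler_pM ?ler0n // ?ler_nat // -natr1.
  by apply: le_trans (_ : eta + 1 + 1 <= _); rewrite ?lerD2r // -addrA.
have loss_n : (c0 * k.+1 <= n)%N.
  rewrite -(ler_nat R); apply: le_trans loss _.
  have le1 : M * eta <= n%:R / 2.
    move: eta_le; rewrite ler_pdivlMl ?mulr_gt0 // ler_pdivlMr //.
    by rewrite [M * eta * 2]mulrC mulrA.
  have le2 : 2 * M <= n%:R / 2.
    rewrite ler_pdivlMr // mulrAC -natrM -natrM ler_nat; apply: leq_trans n_large.
    by rewrite mulnC.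
  by rewrite [leRHS]splitr lerD.
pose alpha' (i : nat) : laurent F := oapp alpha 0 (insub i : option K).
have alphaE (i : K) : alpha' (val i) = alpha i by rewrite /alpha' valK.
pose S := \sum_(f : {poly_ n F})
  addchar R charF (\sum_(r : K) alpha r * lpoly f ^+ val r).
have mean_ge : (#|F|%:R ^+ k)^-1 <= `|mean (fun x : {poly_n F} =>
     addchar R charF (\sum_(r <- K) alpha' r * iota_npoly x ^+ r))| :> R[i].
  have [rho rhoE] : exists rho : R, `|S| = (rho%:C)%C by eexists; exact: normc_def.
  have rho_ge : q%:R `^ (n%:R - eta) <= rho by move: sum_ge; rewrite -/S rhoE.
  have q_gt1 : (1 < q)%N by rewrite -Fq finNzRing_gt1.
  have q0 : 0 < q%:R :> R by rewrite ltr0n ltnW.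
  have -> : mean (fun x : {poly_n F} =>
      addchar R charF (\sum_(r <- K) alpha' r * iota_npoly x ^+ r)) = S / #|{poly_n F}|%:R.
    rewrite /mean /S; congr (_ / _); apply: eq_bigr => f _; congr (addchar _ _ _).
    rewrite [LHS]big_seq_fsetE /=.
    by apply: eq_bigr => i _; rewrite alphaE.
  rewrite normrM normfV normr_nat rhoE qpoly.card_npoly Fq natrX.
  have qk : q%:R ^+ n <= rho * q%:R ^+ k.
    rewrite -!powR_mulrn ?(ltW q0) //.
    have -> : q%:R `^ n%:R = q%:R `^ (n%:R - eta) * q%:R `^ eta :> R.
      by rewrite -powRD ?subrK // (gt_eqF q0) implybT.
    by rewrite ler_pM ?powR_ge0 // ler_powR // ler1n ltnW.
  have cR (j : nat) : (q%:R ^+ j : R[i]) = ((q%:R ^+ j)%:C)%C by rewrite rmorphXn rmorph_nat.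
  rewrite !cR ler_pdivlMr -?cR ?exprn_gt0 ?ltr0n ?(ltnW q_gt1) //.
  rewrite mulrC ler_pdivrMr ?exprn_gt0 ?ltr0n ?(ltnW q_gt1) //.
  by rewrite !cR -rmorphM lecR.
have := layers0 F _ _ charF (addchar_residue_character R charF) n k alpha' loss_n mean_ge.
move=> /(_ (val r) (valP r) (leq0n _)) /approximable_monic[g [g_monic gs gsmall]].
rewrite alphaE in gsmall.
have [a ord_a] := ord_sub_poly R gsmall.
exists a, g; split=> //; last by apply: le_trans loss; rewrite ler_nat.
apply: lt_le_trans ord_a _; rewrite lee_fin -addrA.
have : (val r * n)%:R <= (val r * n - c0 * k.+1)%N%:R + (c0 * k.+1)%:R :> R.
  by rewrite -natrD ler_nat addnC -leq_subLR.
rewrite natrM => H.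
rewrite lerNl opprD opprK lerBlDr; apply: le_trans H _.
by rewrite lerD2l.
Qed.
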